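(* Let $\mathcal{C}$ be a braided $G$-crossed fusion category with a $G$-compatible pivotal structure, where $G$ is a finite cyclic group generated by $g$. Let $[I_{1,n}]$ be a set of representatives, under the action of $\hat G$ by tensoring with the objects $X_\alpha$, of the isomorphism classes of simple objects of $(\mathcal{C}^G)_1$ having trivial stabilizer under this action, and let $[I_g]$ be a set of representatives, under the action of $\hat G$, of the isomorphism classes of simple objects of $(\mathcal{C}^G)_g$. These choices amount to a choice of lifting in $\mathcal{C}^G$ of each simple object $X\in\mathcal{C}_1$ with $T_g(X)\simeq X$ and of each simple object $Y\in\mathcal{C}_g$. Then the crossed $S$-matrix $S_{1,g}$ of $\mathcal{C}$, defined with these liftings, is the submatrix $(S_{X,Y})_{X\in [I_{1,n}],Y\in [I_g]}$ of the $S$-matrix of $\mathcal{C}^G$.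
   Context: $\Bbbk$ is an algebraically closed field of characteristic $0$. A braided $G$-crossed fusion category is a fusion category $\mathcal{C}$ over $\Bbbk$ with a grading $\mathcal{C}=\bigoplus_{h\in G}\mathcal{C}_h$, an action $h\mapsto T_h$ of $G$ by tensor autoequivalences with $T_h(\mathcal{C}_k)\subset\mathcal{C}_{hkh^{-1}}$, and natural isomorphisms $c_{X,Y}\colon X\otimes Y\to T_h(Y)\otimes X$ for $X\in\mathcal{C}_h$, $Y\in\mathcal{C}$, compatible with the $G$-action and satisfying the analogues of the hexagon axioms. The pivotal structure $a_X\colon X\to X^{**}$ is assumed compatible with the action: $T_h(a_X)=a_{T_h(X)}$ for all $h,X$ (up to canonical identifications). The right quantum trace of $f\in\mathrm{End}(X)$ is the scalar $\mathrm{tr}^R_X(f)=\mathrm{ev}_{X^*}\circ((a_X\circ f)\otimes\mathrm{id}_{X^*})\circ\mathrm{coev}_X$. Equivariantization: objects of $\mathcal{C}^G$ are pairs $(X,(u_h)_{h\in G})$ with isomorphisms $u_h\colon T_h(X)\to X$ satisfying $u_{hk}=u_h\circ T_h(u_k)$ (modulo $T_hT_k\simeq T_{hk}$); such a pair is called a lifting of $X$. $\mathcal{C}^G$ is a braided pivotal fusion category: the braiding of $(X,(u_k))$ with $X$ of degree $h$ and $(Y,(v_k))$ is $(v_h\otimes\mathrm{id}_X)\circ c_{X,Y}$, and the pivotal structure is the one of $\mathcal{C}$. Its $S$-matrix is $S_{X,Y}=\mathrm{tr}^R_{X\otimes Y}(c_{Y,X}\circ c_{X,Y})$ for $X,Y$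 simple. It contains $\mathrm{Rep}(G)$: for $\alpha\in\hat G$ (character group), $X_\alpha$ is $\mathbf 1$ with equivariant structure $\alpha(h)\varphi_h$, where $\varphi_h\colon T_h(\mathbf 1)\to\mathbf 1$ is the canonical isomorphism. $\mathcal{C}^G$ is graded by $G$: $(\mathcal{C}^G)_h$ consists of the objects $X$ with $c_{X,X_\alpha}\circ c_{X_\alpha,X}=\alpha(h)\mathrm{id}_{X_\alpha\otimes X}$ for all $\alpha\in\hat G$; liftings of objects of $\mathcal{C}_h$ lie in $(\mathcal{C}^G)_h$. Indexing: each simple $X\in\mathcal{C}_1$ with $T_g(X)\simeq X$ has exactly $\#G$ non-isomorphic liftings, permuted simply transitively by $\hat G$; these liftings are exactly the simple objects of $(\mathcal{C}^G)_1$ with trivial stabilizer. Every simple $Y\in\mathcal{C}_g$ satisfies $T_g(Y)\simeq Y$ and likewise has a $\hat G$-orbit of liftings in $(\mathcal{C}^G)_g$. Crossed $S$-matrix: $S_{1,g}$ has rows indexed by isomorphism classes of simple $X\in\mathcal{C}_1$ with $T_g(X)\simeq X$, columns indexed by isomorphism classes of simple $Y\in\mathcal{C}_g$, and $$(S_{1,g})_{X,Y}=\mathrm{tr}^R_{X\otimes Y}\big((\gamma\otimes\mathrm{id}_Y)\circ c_{Y,X}\circ c_{X,Y}\big),$$ where $c_{X,Y}\colon X\otimes Y\to Y\otimes X$, $c_{Y,X}\colon Y\otimes X\to T_g(X)\otimes Y$, and $\gamma=u_g\colon T_g(X)\to X$ is the isomorphism given by the chosen lifting of $X$. *)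

(* Defs.v *)
From HB Require Import structures.
From mathcomp Require Import all_boot all_order all_algebra all_fingroup.
From mathcomp Require Import cyclic.
Set Implicit Arguments.
Unset Strict Implicit.
Unset Printing Implicit Defensive.
Import GRing.Theory.
Local Open Scope ring_scope.

Reserved Notation "g ∘ f" (at level 40, left associativity).
Reserved Notation "X ⊗ Y" (at level 38, left associativity).
Reserved Notation "f ⊠ g" (at level 38, left associativity).


Record lincat (k : fieldType) := LinCat {
  obj :> Type;
  hom : obj -> obj -> vectType k;
  idm : forall X, hom X X;
  cmp : forall X Y Z, hom Y Z -> hom X Y -> hom X Z;
  cmp1m : forall X Y (f : hom X Y), cmp (idm Y) f = f;
  cmpm1 : forall X Y (f : hom X Y), cmp f (idm X) = f;
  cmpA : forall W X Y Z (h : hom Y Z) (g : hom X Y) (f : hom W X),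
    cmp h (cmp g f) = cmp (cmp h g) f;
  cmp_linl : forall X Y Z a (f f' : hom Y Z) (g : hom X Y),
    cmp (a *: f + f') g = a *: cmp f g + cmp f' g;
  cmp_linr : forall X Y Z a (f : hom Y Z) (g g' : hom X Y),
    cmp f (a *: g + g') = a *: cmp f g + cmp f g' }.

Arguments hom {k l} X Y.
Arguments idm {k l} X.
Notation "g ∘ f" := (cmp g f).

Section LinCat.
Variables (k : fieldType) (C : lincat k).
Implicit Types X Y Z : C.

Definition inverses X Y (f : hom X Y) (g : hom Y X) :=
  f ∘ g = idm Y /\ g ∘ f = idm X.
Definition isiso X Y (f : hom X Y) := exists g, inverses f g.
Definition iso X Y := exists f : hom X Y, isiso f.

Definition mono X Y (f : hom X Y) :=
  forall Z (a b : hom Z X), f ∘ a = f ∘ b -> a = b.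
Definition epi X Y (f : hom X Y) :=
  forall Z (a b : hom Y Z), a ∘ f = b ∘ f -> a = b.

Definition simple X :=
  idm X <> 0 /\
  forall Y (f : hom Y X), mono f -> f = 0 \/ isiso f.

Definition is_kernel X Y (f : hom X Y) K (i : hom K X) :=
  f ∘ i = 0 /\ forall Z (z : hom Z X), f ∘ z = 0 -> exists! w, i ∘ w = z.
Definition is_cokernel X Y (f : hom X Y) K (p : hom Y K) :=
  p ∘ f = 0 /\ forall Z (z : hom Y Z), z ∘ f = 0 -> exists! w, w ∘ p = z.

Definition is_dsum (I : finType) (F : I -> C) X
    (i : forall a, hom (F a) X) (p : forall a, hom X (F a)) :=
  [/\ forall a, p a ∘ i a = idm (F a),
      forall a b, a != b -> p a ∘ i b = 0
    & \sum_a i a ∘ p a = idm X].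

Record abelian_cat : Prop := AbelianCat {
  ab_dsum : forall n (F : 'I_n -> C), exists X i p, @is_dsum 'I_n F X i p;
  ab_ker : forall X Y (f : hom X Y), exists K (i : hom K X), is_kernel f i;
  ab_coker : forall X Y (f : hom X Y), exists K (p : hom Y K), is_cokernel f p;
  ab_mono : forall X Y (f : hom X Y), mono f ->
    exists Z (g : hom Y Z), is_kernel g f;
  ab_epi : forall X Y (f : hom X Y), epi f ->
    exists Z (g : hom Z X), is_cokernel g f }.

Definition semisimple := forall X, exists n (F : 'I_n -> C) i p,
  (forall a, simple (F a)) /\ @is_dsum 'I_n F X i p.

(* F lists, without repetition, the isomorphism classes of objects in P. *)
Definition iso_reps (P : C -> Prop) n (F : 'I_n -> C) :=
  (forall i, P (F i)) /\ forall X, P X -> exists! i, iso X (F i).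

Lemma cmpR X Y Z W (g : hom Y Z) (f : hom X Y) (h : hom X Z) (r : hom W X) :
  g ∘ f = h -> g ∘ (f ∘ r) = h ∘ r.
Proof. by move=> <-; rewrite cmpA. Qed.

Lemma cmp0m X Y Z (g : hom X Y) : (0 : hom Y Z) ∘ g = 0.
Proof.
by apply: (addrI (0 ∘ g)); rewrite -{1}[0 ∘ g]scale1r -cmp_linl scaler0 !addr0.
Qed.

Lemma cmpm0 X Y Z (f : hom Y Z) : f ∘ (0 : hom X Y) = 0.
Proof.
by apply: (addrI (f ∘ 0)); rewrite -{1}[f ∘ 0]scale1r -cmp_linr scaler0 !addr0.
Qed.

Lemma cmpDl X Y Z (f f' : hom Y Z) (g : hom X Y) :
  (f + f') ∘ g = f ∘ g + f' ∘ g.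
Proof. by rewrite -{1}[f]scale1r cmp_linl scale1r. Qed.

Lemma cmpDr X Y Z (f : hom Y Z) (g g' : hom X Y) :
  f ∘ (g + g') = f ∘ g + f ∘ g'.
Proof. by rewrite -{1}[g]scale1r cmp_linr scale1r. Qed.

Lemma cmpZl X Y Z a (f : hom Y Z) (g : hom X Y) : (a *: f) ∘ g = a *: (f ∘ g).
Proof. by rewrite -[a *: f]addr0 cmp_linl cmp0m addr0. Qed.

Lemma cmpZr X Y Z a (f : hom Y Z) (g : hom X Y) : f ∘ (a *: g) = a *: (f ∘ g).
Proof. by rewrite -[a *: g]addr0 cmp_linr cmpm0 addr0. Qed.

Lemma cmp_suml X Y Z (I : finType) (f : I -> hom Y Z) (g : hom X Y) :
  (\sum_i f i) ∘ g = \sum_i f i ∘ g.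
Proof.
by apply: (big_morph (fun x => x ∘ g)) => [? ?|]; rewrite ?cmpDl ?cmp0m.
Qed.

Lemma cmp_sumr X Y Z (I : finType) (f : hom Y Z) (g : I -> hom X Y) :
  f ∘ (\sum_i g i) = \sum_i f ∘ g i.
Proof.
by apply: (big_morph (fun x => f ∘ x)) => [? ?|]; rewrite ?cmpDr ?cmpm0.
Qed.

Lemma cancelr X Y Z (f : hom X Y) (f' : hom Y X) (a b : hom Y Z) :
  f ∘ f' = idm Y -> a ∘ f = b ∘ f -> a = b.
Proof. by move=> E H; rewrite -[a]cmpm1 -[b]cmpm1 -E !cmpA H. Qed.

Lemma cancell X Y Z (f : hom X Y) (f' : hom Y X) (a b : hom Z X) :
  f' ∘ f = idm X -> f ∘ a = f ∘ b -> a = b.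
Proof. by move=> E H; rewrite -[a]cmp1m -[b]cmp1m -E -!cmpA H. Qed.

End LinCat.


Record moncat (k : fieldType) := MonCat {
  mbase :> lincat k;
  one : mbase;
  ten : mbase -> mbase -> mbase;
  tenm : forall X X' Y Y' : mbase,
    hom X X' -> hom Y Y' -> hom (ten X Y) (ten X' Y');
  tenm1 : forall X Y, tenm (idm X) (idm Y) = idm (ten X Y);
  tenmM : forall X X' X'' Y Y' Y'' (f' : hom X' X'') (f : hom X X')
      (g' : hom Y' Y'') (g : hom Y Y'),
    tenm (f' ∘ f) (g' ∘ g) = tenm f' g' ∘ tenm f g;
  tenm_linl : forall X X' Y Y' a (f f' : hom X X') (g : hom Y Y'),
    tenm (a *: f + f') g = a *: tenm f g + tenm f' g;
  tenm_linr : forall X X' Y Y' a (f : hom X X') (g g' : hom Y Y'),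
    tenm f (a *: g + g') = a *: tenm f g + tenm f g';
  ass : forall X Y Z, hom (ten (ten X Y) Z) (ten X (ten Y Z));
  assi : forall X Y Z, hom (ten X (ten Y Z)) (ten (ten X Y) Z);
  assK : forall X Y Z, inverses (ass X Y Z) (assi X Y Z);
  ass_nat : forall X X' Y Y' Z Z' (f : hom X X') (g : hom Y Y') (h : hom Z Z'),
    ass X' Y' Z' ∘ tenm (tenm f g) h = tenm f (tenm g h) ∘ ass X Y Z;
  lun : forall X, hom (ten one X) X;
  luni : forall X, hom X (ten one X);
  lunK : forall X, inverses (lun X) (luni X);
  lun_nat : forall X Y (f : hom X Y), lun Y ∘ tenm (idm one) f = f ∘ lun X;
  run : forall X, hom (ten X one) X;
  runi : forall X, hom X (ten X one);
  runK : forall X, inverses (run X) (runi X);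
  run_nat : forall X Y (f : hom X Y), run Y ∘ tenm f (idm one) = f ∘ run X;
  pentagon : forall W X Y Z,
    ass W X (ten Y Z) ∘ ass (ten W X) Y Z
    = tenm (idm W) (ass X Y Z) ∘ ass W (ten X Y) Z ∘ tenm (ass W X Y) (idm Z);
  triangle : forall X Y,
    tenm (idm X) (lun Y) ∘ ass X one Y = tenm (run X) (idm Y) }.

Arguments one {k m}.
Arguments ass {k m} X Y Z.
Arguments assi {k m} X Y Z.
Arguments lun {k m} X.
Arguments luni {k m} X.
Arguments run {k m} X.
Arguments runi {k m} X.
Arguments assK {k m} X Y Z.
Arguments lunK {k m} X.
Arguments runK {k m} X.
Notation "X ⊗ Y" := (ten X Y).
Notation "f ⊠ g" := (tenm f g).

Section MonCat.
Variables (k : fieldType) (C : moncat k).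
Implicit Types X Y Z W : C.

Lemma tenm0l X X' Y Y' (g : hom Y Y') : (0 : hom X X') ⊠ g = 0.
Proof.
by apply: (addrI (0 ⊠ g)); rewrite -{1}[0 ⊠ g]scale1r -tenm_linl scaler0 !addr0.
Qed.

Lemma tenm0r X X' Y Y' (f : hom X X') : f ⊠ (0 : hom Y Y') = 0.
Proof.
by apply: (addrI (f ⊠ 0)); rewrite -{1}[f ⊠ 0]scale1r -tenm_linr scaler0 !addr0.
Qed.

Lemma tenm_suml X X' Y Y' (I : finType) (f : I -> hom X X') (g : hom Y Y') :
  (\sum_i f i) ⊠ g = \sum_i f i ⊠ g.
Proof.
apply: (big_morph (fun x => x ⊠ g)) => [x y|]; last exact: tenm0l.
by rewrite -{1}[x]scale1r tenm_linl scale1r.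
Qed.

Lemma tenm_sumr X X' Y Y' (I : finType) (f : hom X X') (g : I -> hom Y Y') :
  f ⊠ (\sum_i g i) = \sum_i f ⊠ g i.
Proof.
apply: (big_morph (fun x => f ⊠ x)) => [x y|]; last exact: tenm0r.
by rewrite -{1}[x]scale1r tenm_linr scale1r.
Qed.

Local Ltac nf := rewrite -?cmpA ?cmp1m ?cmpm1.
Local Ltac mrg := rewrite -?tenmM ?cmp1m ?cmpm1.

Lemma tenm_split X X' Y Y' (f : hom X X') (g : hom Y Y') :
  f ⊠ g = (f ⊠ idm Y') ∘ (idm X ⊠ g).
Proof. by mrg. Qed.

Lemma tenm_split' X X' Y Y' (f : hom X X') (g : hom Y Y') :
  f ⊠ g = (idm X' ⊠ g) ∘ (f ⊠ idm Y).
Proof. by mrg. Qed.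

Lemma tenmMl X X' X'' Y (f' : hom X' X'') (f : hom X X') :
  (f' ∘ f) ⊠ idm Y = (f' ⊠ idm Y) ∘ (f ⊠ idm Y).
Proof. by mrg. Qed.

Lemma tenmMr X X' X'' Y (f' : hom X' X'') (f : hom X X') :
  idm Y ⊠ (f' ∘ f) = (idm Y ⊠ f') ∘ (idm Y ⊠ f).
Proof. by mrg. Qed.

Lemma assi_nat X X' Y Y' Z Z' (f : hom X X') (g : hom Y Y') (h : hom Z Z') :
  assi X' Y' Z' ∘ (f ⊠ (g ⊠ h)) = ((f ⊠ g) ⊠ h) ∘ assi X Y Z.
Proof.
apply: (cancelr (assK X Y Z).1); nf; rewrite (assK X Y Z).2 cmpm1 -ass_nat.
by rewrite cmpA (assK _ _ _).2 cmp1m.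
Qed.

Lemma lun_faithful X Y (f g : hom X Y) : idm one ⊠ f = idm one ⊠ g -> f = g.
Proof.
by move=> E; apply: (cancelr (lunK X).1); rewrite -!lun_nat E.
Qed.

Lemma run_faithful X Y (f g : hom X Y) : f ⊠ idm one = g ⊠ idm one -> f = g.
Proof.
by move=> E; apply: (cancelr (runK X).1); rewrite -!run_nat E.
Qed.

Lemma lun_ten X Y : lun (X ⊗ Y) ∘ ass one X Y = lun X ⊠ idm Y.
Proof.
apply: lun_faithful.
apply: (cancelr (f := ass one (one ⊗ X) Y ∘ (ass one one X ⊠ idm Y))
   (f' := (assi one one X ⊠ idm Y) ∘ assi one (one ⊗ X) Y)).
  rewrite -cmpA (cmpA (ass one one X ⊠ _)) -tenmM (assK _ _ _).1 cmp1m tenm1.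
  by rewrite cmp1m (assK _ _ _).1.
rewrite -{1}[idm one]cmp1m tenmM -!cmpA (cmpA (_ ⊠ ass _ _ _)) -pentagon.
rewrite !cmpA triangle -!ass_nat -cmpA -tenmM cmp1m triangle -tenm1.
by rewrite ass_nat.
Qed.

Lemma run_ten X Y : (idm X ⊠ run Y) ∘ ass X Y one = run (X ⊗ Y).
Proof.
apply: run_faithful.
apply: (cancell (f := ass X Y one) (f' := assi X Y one)); first exact: (assK _ _ _).2.
rewrite -(triangle (X ⊗ Y)) tenmMl !cmpA ass_nat.
rewrite -[idm (X ⊗ Y)]tenm1 ass_nat -(triangle Y) tenmMr -!cmpA.
by rewrite (cmpA (_ ⊠ ass _ _ _)) -pentagon.
Qed.

Lemma lun_run : lun one = run one :> hom ((one : C) ⊗ one) one.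
Proof.
apply: run_faithful.
rewrite -lun_ten -triangle; congr (_ ∘ _).
apply: (cancell (f := lun one) (f' := luni one)); first exact: (lunK _).2.
by rewrite lun_nat.
Qed.

End MonCat.

Record rigcat (k : fieldType) := RigCat {
  rbase :> moncat k;
  dual : rbase -> rbase;
  ev : forall X, hom (dual X ⊗ X) one;
  coev : forall X, hom one (X ⊗ dual X);
  zig : forall X,
    run X ∘ (idm X ⊠ ev X) ∘ ass X (dual X) X ∘ (coev X ⊠ idm X) = lun X;
  zag : forall X,
    lun (dual X) ∘ (ev X ⊠ idm (dual X)) ∘ assi (dual X) X (dual X)
      ∘ (idm (dual X) ⊠ coev X) = run (dual X) }.

Arguments dual {k r} X.
Arguments ev {k r} X.
Arguments coev {k r} X.
Arguments zig {k r} X.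
Arguments zag {k r} X.

Section RigCat.
Variables (k : fieldType) (C : rigcat k).
Implicit Types X Y Z W : C.

(* The unique morphism with ev ∘ (curry f ⊠ id) = f, see [ev_curry]. *)
Definition curry Z X (f : hom (Z ⊗ X) one) : hom Z (dual X) :=
  lun (dual X) ∘ (f ⊠ idm (dual X)) ∘ assi Z X (dual X) ∘ (idm Z ⊠ coev X)
    ∘ runi Z.

Definition dualm X Y (f : hom X Y) : hom (dual Y) (dual X) :=
  curry (ev Y ∘ (idm (dual Y) ⊠ f)).

Definition ev2 X Y : hom ((dual Y ⊗ dual X) ⊗ (X ⊗ Y)) one :=
  ev Y ∘ (idm (dual Y) ⊠ (lun Y ∘ (ev X ⊠ idm Y) ∘ assi (dual X) X Y))
    ∘ ass (dual Y) (dual X) (X ⊗ Y).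

Definition dual_ten X Y : hom (dual Y ⊗ dual X) (dual (X ⊗ Y)) :=
  curry (ev2 X Y).

End RigCat.

Section RigTheory.
Variables (k : fieldType) (C : rigcat k).
Implicit Types X Y Z W : C.

Lemma zig_ten Z X :
  run (Z ⊗ X) ∘ (idm (Z ⊗ X) ⊠ ev X) ∘ ass (Z ⊗ X) (dual X) X
    ∘ (assi Z X (dual X) ⊠ idm X) ∘ ((idm Z ⊠ coev X) ⊠ idm X)
  = run Z ⊠ idm X.
Proof.
rewrite -run_ten -tenm1 -!cmpA (cmpA (ass Z X one)) ass_nat -!cmpA.
rewrite (cmpA (ass Z X _)) pentagon -!cmpA (cmpA (_ ⊠ idm X)) -tenmMl.
rewrite (assK _ _ _).1 tenm1 cmp1m ass_nat.
by rewrite -triangle -zig !tenmMr !cmpA.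
Qed.

Lemma zag_ten W X :
  ((run W ∘ (idm W ⊠ ev X) ∘ ass W (dual X) X) ⊠ idm (dual X))
    ∘ assi (W ⊗ dual X) X (dual X) ∘ (idm (W ⊗ dual X) ⊠ coev X)
  = run (W ⊗ dual X).
Proof.
rewrite -run_ten -zag !tenmMr !tenmMl -triangle -tenm1 -!cmpA.
rewrite (cmpA (ass W one _)) ass_nat -!cmpA -ass_nat; do 2 congr (_ ∘ _).
rewrite !cmpA; congr (_ ∘ _).
apply: (@cancell _ _ _ _ _ (idm W ⊠ ass (dual X) X (dual X))
  (idm W ⊠ assi (dual X) X (dual X))).
  by rewrite -tenmMr (assK _ _ _).2 tenm1.
rewrite !cmpA -pentagon -cmpA (assK _ _ _).1 cmpm1 -tenmMr.
by rewrite (assK _ _ _).1 tenm1 cmp1m.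
Qed.

Lemma ev_curry Z X (f : hom (Z ⊗ X) one) : ev X ∘ (curry f ⊠ idm X) = f.
Proof.
rewrite /curry !tenmMl -!cmpA -lun_ten.
rewrite -!cmpA (cmpA (ev X)) -lun_nat -!cmpA (cmpA (ass one _ _)) ass_nat.
rewrite tenm1 -!cmpA (cmpA (_ ⊠ ev X)) -tenmM cmp1m cmpm1.
rewrite (tenm_split f) lun_run.
rewrite -!cmpA (cmpA (run _)) run_nat.
rewrite (_ : _ ∘ _ = f ∘ ((run (Z ⊗ X) ∘ (idm (Z ⊗ X) ⊠ ev X)
  ∘ ass (Z ⊗ X) (dual X) X ∘ (assi Z X (dual X) ⊠ idm X)
  ∘ ((idm Z ⊠ coev X) ⊠ idm X)) ∘ (runi Z ⊠ idm X))); last by rewrite !cmpA.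
by rewrite zig_ten -tenmMl (runK _).1 tenm1 cmpm1.
Qed.

Lemma uncurry_inj W Z X (f g : hom Z (W ⊗ dual X)) :
  run W ∘ (idm W ⊠ ev X) ∘ ass W (dual X) X ∘ (f ⊠ idm X)
  = run W ∘ (idm W ⊠ ev X) ∘ ass W (dual X) X ∘ (g ⊠ idm X) -> f = g.
Proof.
have P h : ((run W ∘ (idm W ⊠ ev X) ∘ ass W (dual X) X ∘ (h ⊠ idm X))
    ⊠ idm (dual X)) ∘ assi Z X (dual X) ∘ (idm Z ⊠ coev X) = h ∘ run Z.
  rewrite tenmMl -(cmpA _ (_ ⊠ _ ⊠ _)) -assi_nat tenm1 -!cmpA -tenmM.
  rewrite -run_nat -zag_ten -!cmpA -tenmM.
  by rewrite !cmp1m !cmpm1.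
by move=> E; apply: (cancelr (runK Z).1); rewrite -!P E.
Qed.

Lemma ev_inj Z X (f g : hom Z (dual X)) :
  ev X ∘ (f ⊠ idm X) = ev X ∘ (g ⊠ idm X) -> f = g.
Proof.
have P (h : hom Z (dual X)) : curry (ev X ∘ (h ⊠ idm X)) = h.
  rewrite /curry tenmMl -!cmpA (cmpA (_ ⊠ _ ⊠ _)) -assi_nat tenm1 -!cmpA.
  rewrite (cmpA (h ⊠ _)) -tenmM cmp1m cmpm1 -{1}[h]cmp1m.
  rewrite -[coev X]cmpm1 tenmM !cmpA zag run_nat -cmpA (runK Z).1.
  by rewrite cmpm1.
by move=> E; rewrite -[f]P -[g]P E.
Qed.

Lemma ev_dualm X Y (f : hom X Y) :
  ev X ∘ (dualm f ⊠ idm X) = ev Y ∘ (idm (dual Y) ⊠ f).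
Proof. exact: ev_curry. Qed.

Lemma dualm1 X : dualm (idm X) = idm (dual X).
Proof. by apply: ev_inj; rewrite ev_dualm. Qed.

Lemma dualmM X Y Z (g : hom Y Z) (f : hom X Y) :
  dualm (g ∘ f) = dualm f ∘ dualm g.
Proof.
apply: ev_inj; rewrite ev_dualm tenmMl cmpA ev_dualm -cmpA -tenm_split'.
by rewrite (tenm_split (dualm g)) cmpA ev_dualm -cmpA -tenmMr.
Qed.

(* The coevaluation is determined by one zigzag identity. *)
Lemma coev_eq X (d : hom one (X ⊗ dual X)) :
  run X ∘ (idm X ⊠ ev X) ∘ ass X (dual X) X ∘ (d ⊠ idm X) = lun X ->
  d = coev X.
Proof. by move=> E; apply: uncurry_inj; rewrite E zig. Qed.

End RigTheory.

(* [piv_ten] says that [piv] is monoidal, both sides being morphisms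
   X ⊗ Y -> (Y^* ⊗ X^* )^*. *)
Record pivcat (k : fieldType) := PivCat {
  pbase :> rigcat k;
  piv : forall X : pbase, hom X (dual (dual X));
  piv_iso : forall X, isiso (piv X);
  piv_nat : forall X Y (f : hom X Y), piv Y ∘ f = dualm (dualm f) ∘ piv X;
  piv_ten : forall X Y, dualm (dual_ten X Y) ∘ piv (X ⊗ Y)
    = dual_ten (dual Y) (dual X) ∘ (piv X ⊠ piv Y) }.

Arguments piv {k p} X.

Section Trace.
Variables (k : fieldType) (C : pivcat k).

(* The scalar a such that f = a *: idm one, when End(one) = k. *)
Definition scalar_of (f : hom (one : C) one) : k :=
  coord [tuple (idm one : hom (one : C) one)] ord0 f.

Definition trR (X : C) (f : hom X X) : k :=
  scalar_of (ev (dual X) ∘ ((piv X ∘ f) ⊠ idm (dual X)) ∘ coev X).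

(* Right duals exist by the pivotal structure, so rigidity is in [rigcat]. *)
Record fusion : Prop := Fusion {
  fus_abelian : abelian_cat C;
  fus_semisimple : semisimple C;
  fus_finite : exists n (F : 'I_n -> C), iso_reps (@simple k C) F;
  fus_one : simple (one : C) }.

End Trace.

Record brcat (k : fieldType) := BrCat {
  bbase :> pivcat k;
  br : forall X Y : bbase, hom (X ⊗ Y) (Y ⊗ X);
  br_iso : forall X Y, isiso (br X Y);
  br_nat : forall X X' Y Y' (f : hom X X') (g : hom Y Y'),
    br X' Y' ∘ (f ⊠ g) = (g ⊠ f) ∘ br X Y;
  br_hex1 : forall X Y Z,
    ass Y Z X ∘ br X (Y ⊗ Z) ∘ ass X Y Z
    = (idm Y ⊠ br X Z) ∘ ass Y X Z ∘ (br X Y ⊠ idm Z);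
  br_hex2 : forall X Y Z,
    assi Z X Y ∘ br (X ⊗ Y) Z ∘ assi X Y Z
    = (br X Z ⊠ idm Y) ∘ assi X Z Y ∘ (idm X ⊠ br Y Z) }.

Arguments br {k b} X Y.

(* Entries of the S-matrix. *)
Definition Sentry (k : fieldType) (B : brcat k) (X Y : B) : k :=
  trR (br Y X ∘ br X Y).


(* Transport along an equality of group elements. *)
Definition acast (k : fieldType) (C : lincat k) (G : Type) (T : G -> C -> C)
    (h l : G) (e : h = l) (X : C) : hom (T h X) (T l X) :=
  match e with erefl => idm (T h X) end.

(* An action of G by tensor autoequivalences, that is, a monoidal functor from
   G to Aut(C): each [ga h] is a linear monoidal functor with structure
   isomorphisms [gaJ] and [ga1], while [gaM] and [gaE] are the monoidal
   isomorphisms ga h (ga l X) -> ga (h * l) X and ga 1 X -> X. *)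
Record gaction (G : finGroupType) (k : fieldType) (C : moncat k) := GAction {
  ga : G -> C -> C;
  gam : forall h (X Y : C), hom X Y -> hom (ga h X) (ga h Y);
  gam1 : forall h X, gam h (idm X) = idm (ga h X);
  gamM : forall h (X Y Z : C) (g : hom Y Z) (f : hom X Y),
    gam h (g ∘ f) = gam h g ∘ gam h f;
  gam_lin : forall h (X Y : C) a (f g : hom X Y),
    gam h (a *: f + g) = a *: gam h f + gam h g;
  gaJ : forall h (X Y : C), hom (ga h (X ⊗ Y)) (ga h X ⊗ ga h Y);
  gaJi : forall h (X Y : C), hom (ga h X ⊗ ga h Y) (ga h (X ⊗ Y));
  gaJK : forall h X Y, inverses (gaJ h X Y) (gaJi h X Y);
  gaJ_nat : forall h (X X' Y Y' : C) (f : hom X X') (g : hom Y Y'),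
    gaJ h X' Y' ∘ gam h (f ⊠ g) = (gam h f ⊠ gam h g) ∘ gaJ h X Y;
  gaJ_ass : forall h X Y Z,
    ass (ga h X) (ga h Y) (ga h Z) ∘ (gaJ h X Y ⊠ idm (ga h Z))
      ∘ gaJ h (X ⊗ Y) Z
    = (idm (ga h X) ⊠ gaJ h Y Z) ∘ gaJ h X (Y ⊗ Z) ∘ gam h (ass X Y Z);
  ga1 : forall h, hom (ga h one) one;
  ga1i : forall h, hom one (ga h one);
  ga1K : forall h, inverses (ga1 h) (ga1i h);
  ga_lun : forall h X,
    lun (ga h X) ∘ (ga1 h ⊠ idm (ga h X)) ∘ gaJ h one X = gam h (lun X);
  ga_run : forall h X,
    run (ga h X) ∘ (idm (ga h X) ⊠ ga1 h) ∘ gaJ h X one = gam h (run X);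
  gaM : forall h l X, hom (ga h (ga l X)) (ga (h * l)%g X);
  gaMi : forall h l X, hom (ga (h * l)%g X) (ga h (ga l X));
  gaMK : forall h l X, inverses (gaM h l X) (gaMi h l X);
  gaM_nat : forall h l (X Y : C) (f : hom X Y),
    gaM h l Y ∘ gam h (gam l f) = gam (h * l)%g f ∘ gaM h l X;
  gaM_J : forall h l X Y,
    (gaM h l X ⊠ gaM h l Y) ∘ gaJ h (ga l X) (ga l Y) ∘ gam h (gaJ l X Y)
    = gaJ (h * l)%g X Y ∘ gaM h l (X ⊗ Y);
  gaM_1 : forall h l, ga1 (h * l)%g ∘ gaM h l one = ga1 h ∘ gam h (ga1 l);
  gaM_ass : forall h l m X,
    gaM (h * l)%g m X ∘ gaM h l (ga m X)
    = acast ga (mulgA h l m) X ∘ gaM h (l * m)%g X ∘ gam h (gaM l m X);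
  gaE : forall X, hom (ga 1%g X) X;
  gaEi : forall X, hom X (ga 1%g X);
  gaEK : forall X, inverses (gaE X) (gaEi X);
  gaE_nat : forall (X Y : C) (f : hom X Y), gaE Y ∘ gam 1%g f = f ∘ gaE X;
  gaE_J : forall X Y, (gaE X ⊠ gaE Y) ∘ gaJ 1%g X Y = gaE (X ⊗ Y);
  gaE_1 : gaE one = ga1 1%g;
  gaE_l : forall h X, acast ga (mul1g h) X ∘ gaM 1%g h X = gaE (ga h X);
  gaE_r : forall h X, acast ga (mulg1 h) X ∘ gaM h 1%g X = gam h (gaE X) }.

(* A G-grading [deg] compatible with the action and a G-crossed braiding.
   Every object is the direct sum of its homogeneous components [hc h X].
   The morphism [cr h X Y] is only constrained when X has degree h. *)
Record crossing (G : finGroupType) (k : fieldType) (C : moncat k)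
    (A : gaction G C) := Crossing {
  deg : G -> C -> Prop;
  deg_iso : forall h X Y, iso X Y -> deg h X -> deg h Y;
  deg_hom0 : forall h l X Y (f : hom X Y),
    deg h X -> deg l Y -> h != l -> f = 0;
  deg_one : deg 1%g one;
  deg_ten : forall h l X Y, deg h X -> deg l Y -> deg (h * l)%g (X ⊗ Y);
  deg_act : forall h l X, deg l X -> deg (h * l * h^-1)%g (ga A h X);
  hc : G -> C -> C;
  hc_deg : forall h X, deg h (hc h X);
  hc_in : forall X h, hom (hc h X) X;
  hc_pr : forall X h, hom X (hc h X);
  hc_dsum : forall X, @is_dsum _ _ G (fun h => hc h X) X (hc_in X) (hc_pr X);
  cr : forall h (X Y : C), hom (X ⊗ Y) (ga A h Y ⊗ X);
  cr_iso : forall h X Y, deg h X -> isiso (cr h X Y);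
  cr_nat : forall h (X X' Y Y' : C) (f : hom X X') (g : hom Y Y'),
    deg h X -> deg h X' ->
    cr h X' Y' ∘ (f ⊠ g) = (gam A h g ⊠ f) ∘ cr h X Y;
  cr_act : forall h l X Y, deg l X ->
    (gaM A h l Y ⊠ idm (ga A h X)) ∘ gaJ A h (ga A l Y) X ∘ gam A h (cr l X Y)
    = ((acast (ga A) (mulgKV h (h * l)%g) Y ∘ gaM A (h * l * h^-1)%g h Y)
         ⊠ idm (ga A h X))
      ∘ cr (h * l * h^-1)%g (ga A h X) (ga A h Y) ∘ gaJ A h X Y;
  cr_hex1 : forall h X Y Z, deg h X ->
    ass (ga A h Y) (ga A h Z) X ∘ (gaJ A h Y Z ⊠ idm X) ∘ cr h X (Y ⊗ Z)
      ∘ ass X Y Z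
    = (idm (ga A h Y) ⊠ cr h X Z) ∘ ass (ga A h Y) X Z ∘ (cr h X Y ⊠ idm Z);
  cr_hex2 : forall h l X Y Z, deg h X -> deg l Y ->
    assi (ga A (h * l)%g Z) X Y ∘ cr (h * l)%g (X ⊗ Y) Z ∘ assi X Y Z
    = (((gaM A h l Z ⊠ idm X) ∘ cr h X (ga A l Z)) ⊠ idm Y)
      ∘ assi X (ga A l Z) Y ∘ (idm X ⊠ cr l Y Z) }.

(* The canonical isomorphism T_h(X^* ) -> T_h(X)^*. *)
Definition gaK (G : finGroupType) (k : fieldType) (C : rigcat k)
    (A : gaction G C) (h : G) (X : C) : hom (ga A h (dual X)) (dual (ga A h X)) :=
  curry (ga1 A h ∘ gam A h (ev X) ∘ gaJi A h (dual X) X).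

(* Braided G-crossed categories with a G-compatible pivotal structure: [xpiv]
   says T_h(a_X) = a_(T_h X), after identifying T_h(X^** ) with T_h(X)^**. *)
Record crossedcat (k : fieldType) (G : finGroupType) := CrossedCat {
  xbase :> pivcat k;
  xact : gaction G xbase;
  xcr : crossing xact;
  xpiv : forall h X, gaK xact h (dual X) ∘ gam xact h (piv X)
    = dualm (gaK xact h X) ∘ piv (ga xact h X) }.

Arguments xact {k G} c.
Arguments xcr {k G} c.


(* [eqlift] is the family (u_h); the identification T_h T_l = T_hl is [gaM]. *)
Record eqobj (k : fieldType) (G : finGroupType) (C : crossedcat k G) := EqObj {
  eqbase : C;
  eqlift : forall h, hom (ga (xact C) h eqbase) eqbase;
  eqlift_iso : forall h, isiso (eqlift h);
  eqliftM : forall h l, eqlift (h * l)%g ∘ gaM (xact C) h l eqbase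
    = eqlift h ∘ gam (xact C) h (eqlift l) }.

Section Lifts.
Variables (k : fieldType) (G : finGroupType) (C : crossedcat k G).
Local Notation A := (xact C).
Local Notation T := (ga A).
Implicit Types (X Y : C) (h l : G).

Lemma fam_cast X (u : forall h, hom (T h X) X) h l (e : h = l) :
  u l ∘ acast T e X = u h.
Proof. by case: l / e; rewrite cmpm1. Qed.

Lemma acastK h l (e : h = l) X : acast T (esym e) X ∘ acast T e X = idm _.
Proof. by case: l / e; rewrite cmp1m. Qed.

Definition fam_inv X (u : forall h, hom (T h X) X) h : hom X (T h X) :=
  gam A h (u h^-1)%g ∘ gaMi A h h^-1 X ∘ acast T (esym (mulgV h)) X ∘ gaEi A X.

Lemma fam_invr X (u : forall h, hom (T h X) X) :
  (forall h l, u (h * l)%g ∘ gaM A h l X = u h ∘ gam A h (u l)) ->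
  u 1%g = gaE A X -> forall h, u h ∘ fam_inv u h = idm X.
Proof.
move=> uM u1 h; rewrite /fam_inv !cmpA -uM -(cmpA _ (gaM _ _ _ _)).
by rewrite (gaMK A _ _ _).1 cmpm1 fam_cast u1 (gaEK A X).1.
Qed.

Lemma fam_iso X (u : forall h, hom (T h X) X) :
  (forall h l, u (h * l)%g ∘ gaM A h l X = u h ∘ gam A h (u l)) ->
  u 1%g = gaE A X -> forall h, isiso (u h).
Proof.
move=> uM u1 h; exists (fam_inv u h); split; first exact: fam_invr.
pose r := gaE A X ∘ acast T (mulgV h) X ∘ gaM A h h^-1 X
  ∘ gam A h (fam_inv u h^-1)%g.
have E : fam_inv u h ∘ r = idm _.
  rewrite /fam_inv /r -!cmpA (cmpA (gaEi A X)) (gaEK A X).2 cmp1m.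
  rewrite (cmpA (acast _ _ _)) acastK.
  by rewrite cmp1m (cmpA (gaMi _ _ _ _)) (gaMK A _ _ _).2 cmp1m -gamM fam_invr ?gam1.
have -> : u h = r by rewrite -[u h]cmpm1 -E cmpA fam_invr ?cmp1m.
exact: E.
Qed.

Lemma eqlift1 (X : eqobj C) : eqlift X 1%g = gaE A (eqbase X).
Proof.
have [v [uv vu]] := eqlift_iso X 1%g.
have E : gaE A (T 1%g (eqbase X)) = gam A 1%g (eqlift X 1%g).
  apply: (cancell vu).
  by rewrite -eqliftM -gaE_l cmpA fam_cast.
apply: (cancelr (gaEK A _).1).
by rewrite -gaE_nat -E.
Qed.


Lemma gam0 h X Y : gam A h (0 : hom X Y) = 0.
Proof.
by apply: (addrI (gam A h 0)); rewrite -{1}[gam A h 0]scale1r -gam_lin scaler0 !addr0.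
Qed.

Lemma gamZ h X Y a (f : hom X Y) : gam A h (a *: f) = a *: gam A h f.
Proof. by rewrite -[a *: f]addr0 gam_lin gam0 addr0. Qed.

Lemma gam_sum h X Y (I : finType) (f : I -> hom X Y) :
  gam A h (\sum_i f i) = \sum_i gam A h (f i).
Proof.
apply: (big_morph (fun x => gam A h x)) => [x y|]; last exact: gam0.
by rewrite -{1}[x]scale1r gam_lin scale1r.
Qed.

Lemma gam_inv h X Y (f : hom X Y) f' : inverses f f' ->
  inverses (gam A h f) (gam A h f').
Proof. by case=> E E'; split; rewrite -gamM ?E ?E' gam1. Qed.

Lemma gam_iso h X Y (f : hom X Y) : isiso f -> isiso (gam A h f).
Proof. by case=> g /gam_inv I; exists (gam A h g). Qed.

Lemma one_liftM (a : G -> k) : a 1%g = 1 -> (forall h l, a (h * l)%g = a h * a l) ->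
  forall h l, (a (h * l)%g *: ga1 A (h * l)%g) ∘ gaM A h l one
    = (a h *: ga1 A h) ∘ gam A h (a l *: ga1 A l).
Proof.
by move=> a1 aM h l; rewrite gamZ cmpZr !cmpZl scalerA gaM_1 aM mulrC.
Qed.

Lemma one_lift_iso (a : G -> k) : a 1%g = 1 -> (forall h l, a (h * l)%g = a h * a l) ->
  forall h, isiso (a h *: ga1 A h).
Proof.
move=> a1 aM; apply: (fam_iso (one_liftM a1 aM)).
by rewrite a1 scale1r gaE_1.
Qed.

Lemma one_liftM1 h l : ga1 A (h * l)%g ∘ gaM A h l one = ga1 A h ∘ gam A h (ga1 A l).
Proof. exact: gaM_1. Qed.

Lemma one_lift_iso1 h : isiso (ga1 A h).
Proof. by exists (ga1i A h); exact: ga1K. Qed.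


Definition ten_lift (X Y : eqobj C) h :
    hom (T h (eqbase X ⊗ eqbase Y)) (eqbase X ⊗ eqbase Y) :=
  (eqlift X h ⊠ eqlift Y h) ∘ gaJ A h (eqbase X) (eqbase Y).

Lemma ten_liftM (X Y : eqobj C) h l :
  ten_lift X Y (h * l)%g ∘ gaM A h l _ = ten_lift X Y h ∘ gam A h (ten_lift X Y l).
Proof.
rewrite /ten_lift -cmpA -gaM_J !cmpA -tenmM !eqliftM tenmM gamM !cmpA.
by congr (_ ∘ _); rewrite -!cmpA gaJ_nat.
Qed.

Lemma tenm_iso X X' Y Y' (f : hom X X') (g : hom Y Y') :
  isiso f -> isiso g -> isiso (f ⊠ g).
Proof.
move=> [f' [f1 f2]] [g' [g1 g2]]; exists (f' ⊠ g').
by split; rewrite -tenmM ?f1 ?g1 ?f2 ?g2 tenm1.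
Qed.

Lemma cmp_iso (X Y Z : C) (g : hom Y Z) (f : hom X Y) : isiso g -> isiso f -> isiso (g ∘ f).
Proof.
move=> [g' [g1 g2]] [f' [f1 f2]]; exists (f' ∘ g'); split.
  by rewrite -cmpA (cmpA f) f1 cmp1m.
by rewrite -cmpA (cmpA g') g2 cmp1m.
Qed.

Lemma ten_lift_iso (X Y : eqobj C) h : isiso (ten_lift X Y h).
Proof.
apply: cmp_iso; last by exists (gaJi A h _ _); exact: gaJK.
by apply: tenm_iso; apply: eqlift_iso.
Qed.


Definition dual_lift (X : eqobj C) h :
    hom (T h (dual (eqbase X))) (dual (eqbase X)) :=
  dualm (fam_inv (eqlift X) h) ∘ gaK A h (eqbase X).

Lemma eqlift_invr (X : eqobj C) h : eqlift X h ∘ fam_inv (eqlift X) h = idm _.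
Proof. by apply: fam_invr; [exact: eqliftM | exact: eqlift1]. Qed.

Lemma eqlift_invl (X : eqobj C) h : fam_inv (eqlift X) h ∘ eqlift X h = idm _.
Proof.
have [v [uv vu]] := eqlift_iso X h.
suff -> : fam_inv (eqlift X) h = v by [].
by apply: (cancell vu); rewrite eqlift_invr uv.
Qed.

Lemma ev_equiv (X : eqobj C) h :
  ev (eqbase X) ∘ (dual_lift X h ⊠ eqlift X h) ∘ gaJ A h _ _
  = ga1 A h ∘ gam A h (ev (eqbase X)).
Proof.
rewrite tenm_split' cmpA -ev_dualm -!cmpA (cmpA (dualm _ ⊠ _)) -tenmM cmp1m.
rewrite /dual_lift (cmpA (dualm _)) -dualmM eqlift_invl dualm1 cmp1m cmpA ev_curry -!cmpA (gaJK A _ _ _).2.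
by rewrite cmpm1.
Qed.

Lemma dual_lift_uniq (X : eqobj C) h (w : hom (T h (dual (eqbase X))) _) :
  ev (eqbase X) ∘ (w ⊠ eqlift X h) = ev (eqbase X) ∘ (dual_lift X h ⊠ eqlift X h) ->
  w = dual_lift X h.
Proof.
move=> E; apply: ev_inj.
apply: (cancelr (f := idm _ ⊠ eqlift X h) (f' := idm _ ⊠ fam_inv (eqlift X) h)).
  by rewrite -tenmM eqlift_invr cmp1m tenm1.
by rewrite -!cmpA -!tenm_split.
Qed.

Lemma ev_equiv' (X : eqobj C) h :
  ev (eqbase X) ∘ (dual_lift X h ⊠ eqlift X h)
  = ga1 A h ∘ gam A h (ev (eqbase X)) ∘ gaJi A h _ _.
Proof.
by rewrite -ev_equiv -cmpA (gaJK A _ _ _).1 cmpm1.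
Qed.

Lemma dual_famM (X : eqobj C) (w : forall h, hom (T h (dual (eqbase X))) _) :
  (forall h, ev (eqbase X) ∘ (w h ⊠ eqlift X h)
    = ga1 A h ∘ gam A h (ev (eqbase X)) ∘ gaJi A h _ _) ->
  forall h l, w (h * l)%g ∘ gaM A h l _ = w h ∘ gam A h (w l).
Proof.
move=> wE h l.
have [y [xy yx]] : isiso (eqlift X (h * l)%g ∘ gaM A h l (eqbase X)).
  by apply: cmp_iso; [exact: eqlift_iso | exists (gaMi A h l _); exact: gaMK].
apply: ev_inj.
apply: (cancelr (f := idm _ ⊠ (eqlift X (h * l)%g ∘ gaM A h l (eqbase X)))
  (f' := idm _ ⊠ y)); first by rewrite -tenmM xy cmp1m tenm1.
rewrite -!cmpA -!tenm_split {2}eqliftM !tenmM !cmpA !wE.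
apply: (cancelr (gaJK A h _ _).1); apply: (cancelr (gam_inv h (gaJK A l _ _)).1).
rewrite -!cmpA (cmpA (gaM _ _ _ _ ⊠ _)) gaM_J (cmpA (gaJi A _ _ _)).
rewrite (cmpA (gaJi A _ _ _)) (gaJK A _ _ _).2.
rewrite cmp1m -gaM_nat (cmpA (ga1 _ _)) gaM_1.
rewrite -!cmpA (cmpA (gam A h _ ⊠ _)) -gaJ_nat !(cmpA (gaJi A _ _ _)) (gaJK A _ _ _).2.
rewrite cmp1m -!gamM (cmpA (ev _)) wE -!cmpA (gaJK A _ _ _).2.
by rewrite cmpm1.
Qed.

Lemma dual_liftM (X : eqobj C) h l :
  dual_lift X (h * l)%g ∘ gaM A h l _ = dual_lift X h ∘ gam A h (dual_lift X l).
Proof. by apply: (@dual_famM X) => {}h; exact: ev_equiv'. Qed.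
Lemma dual_lift1 (X : eqobj C) : dual_lift X 1%g = gaE A _.
Proof.
apply/esym/dual_lift_uniq; rewrite ev_equiv' eqlift1.
apply: (cancelr (gaJK A 1%g _ _).1).
rewrite -!cmpA gaE_J (gaJK A _ _ _).2 cmpm1 -gaE_1.
by rewrite gaE_nat.
Qed.

Lemma dual_lift_iso (X : eqobj C) h : isiso (dual_lift X h).
Proof. exact: fam_iso (dual_liftM X) (dual_lift1 X) h. Qed.

Lemma coev_fam (X : eqobj C) h (w : hom (T h (dual (eqbase X))) _) :
  ev (eqbase X) ∘ (w ⊠ eqlift X h)
    = ga1 A h ∘ gam A h (ev (eqbase X)) ∘ gaJi A h _ _ ->
  run (eqbase X) ∘ (idm (eqbase X) ⊠ ev (eqbase X))
    ∘ ass (eqbase X) (dual (eqbase X)) (eqbase X)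
    ∘ (((eqlift X h ⊠ w) ∘ gaJ A h _ _ ∘ gam A h (coev (eqbase X)))
       ⊠ eqlift X h)
  = lun (eqbase X) ∘ (ga1 A h ⊠ eqlift X h).
Proof.
move=> wE; apply: (cancelr (gaJK A h _ _).1).
have E1 : ((eqlift X h ⊠ w) ∘ gaJ A h _ _ ∘ gam A h (coev (eqbase X)))
       ⊠ eqlift X h
  = ((eqlift X h ⊠ w) ⊠ eqlift X h)
    ∘ ((gaJ A h _ _ ⊠ idm _) ∘ (gam A h (coev (eqbase X)) ⊠ gam A h (idm _))).
  by rewrite -!tenmM !cmpA gam1 !cmpm1.
rewrite E1 -!cmpA -gaJ_nat (cmpA (ass _ _ _)) ass_nat -!cmpA.
rewrite (cmpA (gaJ A h _ _ ⊠ _)) (cmpA (ass _ _ _)) (cmpA (ass _ _ _)) gaJ_ass.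
rewrite (cmpA (_ ⊠ ev _)) -tenmM cmp1m wE -!cmpA (cmpA (_ ⊠ (_ ∘ _))) -tenmM.
rewrite cmpm1 -!cmpA (gaJK A _ _ _).2 cmpm1 -[eqlift X h in LHS]cmp1m.
rewrite tenm_split !tenmMr -!cmpA.
rewrite (cmpA (run _)) run_nat -!cmpA.
rewrite -{2}(gam1 A h) (cmpA (_ ⊠ gam A h (ev _))) -gaJ_nat.
rewrite -!cmpA (cmpA (_ ⊠ ga1 A h)) (cmpA (run _)) (cmpA (run _)) ga_run.
rewrite -!gamM !cmpA zig -ga_lun.
by rewrite (tenm_split' (ga1 A h) (eqlift X h)) !cmpA lun_nat -!cmpA cmp1m.
Qed.

Lemma coev_equiv (X : eqobj C) h :
  coev (eqbase X) ∘ ga1 A h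
  = (eqlift X h ⊠ dual_lift X h) ∘ gaJ A h _ _ ∘ gam A h (coev (eqbase X)).
Proof.
have := coev_fam (ev_equiv' X h); set d := _ ∘ gam _ _ _ => E.
suff D : d ∘ ga1i A h = coev (eqbase X) by rewrite -D -cmpA (ga1K A _).2 cmpm1.
apply: coev_eq; move: d E => d E.
apply: (cancelr (f := ga1 A h ⊠ eqlift X h) (f' := ga1i A h ⊠ fam_inv (eqlift X) h)).
  by rewrite -tenmM (ga1K A _).1 eqlift_invr tenm1.
have E' : ((d ∘ ga1i A h) ⊠ idm (eqbase X)) ∘ (ga1 A h ⊠ eqlift X h)
  = d ⊠ eqlift X h by rewrite -tenmM -cmpA (ga1K A _).2 cmpm1 cmp1m.
by rewrite -E -E' !cmpA.
Qed.

Definition eq_dual (X : eqobj C) : eqobj C :=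
  EqObj (dual_lift_iso X) (dual_liftM X).
Definition eq_ten (X Y : eqobj C) : eqobj C :=
  EqObj (ten_lift_iso X Y) (ten_liftM X Y).
Definition eq_one : eqobj C := EqObj one_lift_iso1 one_liftM1.

Lemma piv_equiv (X : eqobj C) h :
  piv (eqbase X) ∘ eqlift X h
  = eqlift (eq_dual (eq_dual X)) h ∘ gam A h (piv (eqbase X)).
Proof.
rewrite /= {1}/dual_lift -cmpA xpiv cmpA -dualmM piv_nat.
congr (dualm _ ∘ _); rewrite -[LHS]cmpm1 -(eqlift_invr (eq_dual X) h) cmpA.
congr (_ ∘ _); rewrite /= /dual_lift cmpA -dualmM eqlift_invl dualm1.
by rewrite cmp1m.
Qed.

End Lifts.


Section EqHom.
Variables (k : fieldType) (G : finGroupType) (C : crossedcat k G).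
Local Notation A := (xact C).

Definition eqdef (X Y : eqobj C) (h : G) (f : hom (eqbase X) (eqbase Y)) :
    hom (ga A h (eqbase X)) (eqbase Y) :=
  f ∘ eqlift X h - eqlift Y h ∘ gam A h f.

Fact eqdef_linear X Y h : linear (@eqdef X Y h).
Proof.
move=> a f g; rewrite /eqdef cmp_linl gam_lin cmp_linr scalerBr.
by rewrite opprD addrACA.
Qed.

HB.instance Definition _ X Y h := GRing.isLinear.Build k
  (hom (eqbase X) (eqbase Y)) (hom (ga A h (eqbase X)) (eqbase Y)) _
  (@eqdef X Y h) (@eqdef_linear X Y h).

(* Morphisms f with f ∘ u_h = v_h ∘ T_h(f) for all h, see [eqhomP]. *)
Definition eqhom (X Y : eqobj C) : {vspace hom (eqbase X) (eqbase Y)} :=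
  (\bigcap_(h : G) lker (linfun (@eqdef X Y h)))%VS.

Lemma eqhomP X Y (f : hom (eqbase X) (eqbase Y)) :
  reflect (forall h, f ∘ eqlift X h = eqlift Y h ∘ gam A h f) (f \in eqhom X Y).
Proof.
rewrite memvE; apply: (iffP subv_bigcapP) => E h; last first.
  by rewrite -memvE memv_ker lfunE /= /eqdef E subrr.
by have := E h isT; rewrite -memvE memv_ker lfunE /= /eqdef subr_eq0 => /eqP.
Qed.

Definition eqmk X Y (f : hom (eqbase X) (eqbase Y))
    (H : forall h, f ∘ eqlift X h = eqlift Y h ∘ gam A h f) : subvs_of (eqhom X Y) :=
  Subvs (introT (@eqhomP X Y f) H).

Lemma eqhomE X Y (f : subvs_of (eqhom X Y)) h :
  vsval f ∘ eqlift X h = eqlift Y h ∘ gam A h (vsval f).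
Proof. exact: (elimT (@eqhomP X Y _) (subvsP f)). Qed.

Fact eq_idm_def X h : idm (eqbase X) ∘ eqlift X h = eqlift X h ∘ gam A h (idm _).
Proof. by rewrite gam1 cmp1m cmpm1. Qed.

Fact eq_cmp_def X Y Z (g : subvs_of (eqhom Y Z)) (f : subvs_of (eqhom X Y)) h :
  (vsval g ∘ vsval f) ∘ eqlift X h = eqlift Z h ∘ gam A h (vsval g ∘ vsval f).
Proof. by rewrite -cmpA eqhomE cmpA eqhomE -cmpA gamM. Qed.

Program Definition eq_lincat : lincat k := {|
  obj := eqobj C;
  hom X Y := subvs_of (eqhom X Y);
  idm X := eqmk (eq_idm_def X);
  cmp X Y Z g f := eqmk (eq_cmp_def g f) |}.
Next Obligation. by move=> *; apply: subvs_inj; apply: cmp1m. Qed.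
Next Obligation. by move=> *; apply: subvs_inj; apply: cmpm1. Qed.
Next Obligation. by move=> *; apply: subvs_inj; apply: cmpA. Qed.
Next Obligation. by move=> *; apply: subvs_inj; apply: cmp_linl. Qed.
Next Obligation. by move=> *; apply: subvs_inj; apply: cmp_linr. Qed.

End EqHom.
Section Equivariantization.
Variables (k : fieldType) (G : finGroupType) (C : crossedcat k G).
Local Notation A := (xact C).
Local Notation T := (ga A).
Implicit Types (X Y Z : eqobj C) (h l : G).

Fact eq_inv_def X Y (f : hom (eqbase X) (eqbase Y)) f' : inverses f f' ->
  (forall h, f ∘ eqlift X h = eqlift Y h ∘ gam A h f) ->
  forall h, f' ∘ eqlift Y h = eqlift X h ∘ gam A h f'.
Proof.
move=> I E h; have [_ V] := gam_inv h I; have [W _] := gam_inv h I.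
apply: (cancelr W); rewrite -!cmpA V -E cmpA I.2.
by rewrite cmp1m cmpm1.
Qed.

Lemma eq_inverses X Y (f : @hom k (eq_lincat C) X Y) (g : @hom k (eq_lincat C) Y X) :
  inverses (vsval f) (vsval g) -> inverses f g.
Proof. by case=> E E'; split; apply: subvs_inj. Qed.

Lemma eq_isiso X Y (f : @hom k (eq_lincat C) X Y) : isiso (vsval f) -> isiso f.
Proof.
case=> g I.
exists (eqmk (eq_inv_def I (eqhomE f)) : @hom k (eq_lincat C) Y X).
exact: eq_inverses.
Qed.

Fact eq_tenm_def X X' Y Y' (f : subvs_of (eqhom X X')) (g : subvs_of (eqhom Y Y')) h :
  (vsval f ⊠ vsval g) ∘ eqlift (eq_ten X Y) h
  = eqlift (eq_ten X' Y') h ∘ gam A h (vsval f ⊠ vsval g).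
Proof. by rewrite /= /ten_lift cmpA -tenmM !eqhomE tenmM -!cmpA gaJ_nat. Qed.

Fact eq_ass_def X Y Z h :
  ass (eqbase X) (eqbase Y) (eqbase Z) ∘ eqlift (eq_ten (eq_ten X Y) Z) h
  = eqlift (eq_ten X (eq_ten Y Z)) h ∘ gam A h (ass _ _ _).
Proof.
rewrite /= /ten_lift /= /ten_lift -[X in _ ⊠ X]cmpm1 tenmM !cmpA ass_nat.
rewrite -[eqlift X h in RHS]cmpm1 tenmM -!cmpA; congr (_ ∘ _).
by rewrite !cmpA gaJ_ass.
Qed.

Fact eq_lun_def X h : lun (eqbase X) ∘ eqlift (eq_ten (eq_one C) X) h
  = eqlift X h ∘ gam A h (lun _).
Proof.
by rewrite /= /ten_lift /= -ga_lun tenm_split' !cmpA lun_nat.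
Qed.

Fact eq_run_def X h : run (eqbase X) ∘ eqlift (eq_ten X (eq_one C)) h
  = eqlift X h ∘ gam A h (run _).
Proof.
by rewrite /= /ten_lift /= -ga_run tenm_split !cmpA run_nat.
Qed.

Program Definition eq_moncat : moncat k := {|
  mbase := eq_lincat C;
  one := eq_one C;
  ten := @eq_ten _ _ C;
  tenm X X' Y Y' f g := @eqmk _ _ _ (eq_ten X Y) (eq_ten X' Y') _ (eq_tenm_def f g);
  ass X Y Z := @eqmk _ _ _ (eq_ten (eq_ten X Y) Z)
    (eq_ten X (eq_ten Y Z)) _ (@eq_ass_def X Y Z);
  assi X Y Z := @eqmk _ _ _ (eq_ten X (eq_ten Y Z))
    (eq_ten (eq_ten X Y) Z) _ (@eq_inv_def (eq_ten (eq_ten X Y) Z) (eq_ten X (eq_ten Y Z)) _ _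
      (assK _ _ _) (@eq_ass_def X Y Z));
  lun X := @eqmk _ _ _ (eq_ten (eq_one C) X) X _ (@eq_lun_def X);
  luni X := @eqmk _ _ _ X (eq_ten (eq_one C) X) _
    (@eq_inv_def (eq_ten (eq_one C) X) X _ _ (lunK _) (@eq_lun_def X));
  run X := @eqmk _ _ _ (eq_ten X (eq_one C)) X _ (@eq_run_def X);
  runi X := @eqmk _ _ _ X (eq_ten X (eq_one C)) _
    (@eq_inv_def (eq_ten X (eq_one C)) X _ _ (runK _) (@eq_run_def X)) |}.
Next Obligation. by move=> *; apply: subvs_inj; apply: tenm1. Qed.
Next Obligation. by move=> *; apply: subvs_inj; apply: tenmM. Qed.
Next Obligation. by move=> *; apply: subvs_inj; apply: tenm_linl. Qed.
Next Obligation. by move=> *; apply: subvs_inj; apply: tenm_linr. Qed.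
Next Obligation. by move=> *; apply: eq_inverses; apply: assK. Qed.
Next Obligation. by move=> *; apply: subvs_inj; apply: ass_nat. Qed.
Next Obligation. by move=> *; apply: eq_inverses; apply: lunK. Qed.
Next Obligation. by move=> *; apply: subvs_inj; apply: lun_nat. Qed.
Next Obligation. by move=> *; apply: eq_inverses; apply: runK. Qed.
Next Obligation. by move=> *; apply: subvs_inj; apply: run_nat. Qed.
Next Obligation. by move=> *; apply: subvs_inj; apply: pentagon. Qed.
Next Obligation. by move=> *; apply: subvs_inj; apply: triangle. Qed.

Fact eq_ev_def X h : ev (eqbase X) ∘ eqlift (eq_ten (eq_dual X) X) h
  = eqlift (eq_one C) h ∘ gam A h (ev _).
Proof. by rewrite /= -ev_equiv cmpA. Qed.

Fact eq_coev_def X h : coev (eqbase X) ∘ eqlift (eq_one C) h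
  = eqlift (eq_ten X (eq_dual X)) h ∘ gam A h (coev _).
Proof. exact: coev_equiv. Qed.

Program Definition eq_rigcat : rigcat k := {|
  rbase := eq_moncat;
  dual := @eq_dual _ _ C;
  ev X := @eqmk _ _ _ (eq_ten (eq_dual X) X) (eq_one C) _ (@eq_ev_def X);
  coev X := @eqmk _ _ _ (eq_one C) (eq_ten X (eq_dual X)) _ (@eq_coev_def X) |}.
Next Obligation. by move=> *; apply: subvs_inj; apply: zig. Qed.
Next Obligation. by move=> *; apply: subvs_inj; apply: zag. Qed.

Program Definition eq_pivcat : pivcat k := {|
  pbase := eq_rigcat;
  piv X := @eqmk _ _ _ X (eq_dual (eq_dual X)) _ (@piv_equiv _ _ _ X) |}.
Next Obligation. by move=> *; apply: eq_isiso; apply: piv_iso. Qed.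
Next Obligation. by move=> *; apply: subvs_inj; apply: piv_nat. Qed.
Next Obligation. by move=> *; apply: subvs_inj; apply: piv_ten. Qed.

End Equivariantization.
Section EqBraiding.
Variables (k : fieldType) (G : finGroupType) (C : crossedcat k G).
Local Notation A := (xact C).
Local Notation B := (xcr C).
Local Notation T := (ga A).
Implicit Types (X Y Z : eqobj C) (h l : G).

(* On the component of degree h of X this is (v_h ⊠ id) ∘ c_{X,Y}, where v is
   the lifting of Y; see [cbrE]. *)
Definition cbr (X : C) (Y : eqobj C) : hom (X ⊗ eqbase Y) (eqbase Y ⊗ X) :=
  \sum_(h : G) (eqlift Y h ⊠ hc_in B X h) ∘ cr B h (hc B h X) (eqbase Y)
    ∘ (hc_pr B X h ⊠ idm (eqbase Y)).

Lemma cbrE h (X' X : C) (i : hom X' X) (Y : eqobj C) : deg B h X' ->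
  cbr X Y ∘ (i ⊠ idm (eqbase Y)) = (eqlift Y h ⊠ i) ∘ cr B h X' (eqbase Y).
Proof.
move=> dX'; have [_ _ D] := hc_dsum B X.
have Z l : l != h -> hc_pr B X l ∘ i = 0.
  by move=> n; apply: deg_hom0 dX' (hc_deg B l X) _; rewrite eq_sym.
have I : hc_in B X h ∘ (hc_pr B X h ∘ i) = i.
  rewrite -[RHS]cmp1m -D cmp_suml (bigD1 h) //= big1 ?addr0 ?cmpA // => l n.
  by rewrite -cmpA Z // cmpm0.
rewrite cmp_suml (bigD1 h) //= big1 ?addr0 => [|l n]; last first.
  by rewrite -cmpA -tenmM Z // tenm0l cmpm0.
rewrite -!cmpA -tenmM [idm _ ∘ idm _]cmp1m cr_nat //; last exact: hc_deg.
by rewrite cmpA -tenmM gam1 I !cmpm1.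
Qed.

Lemma epi_sum (W Z : C) (V : G -> C) (a : forall h, hom (V h) W)
    (b : forall h, hom W (V h)) (f g : hom W Z) :
  \sum_h a h ∘ b h = idm W -> (forall h, f ∘ a h = g ∘ a h) -> f = g.
Proof.
move=> D E; rewrite -[f]cmpm1 -[g]cmpm1 -D !cmp_sumr.
by apply: eq_bigr => h _; rewrite !cmpA E.
Qed.

Lemma hc_epi (X Y Z : C) (f g : hom (X ⊗ Y) Z) :
  (forall h, f ∘ (hc_in B X h ⊠ idm Y) = g ∘ (hc_in B X h ⊠ idm Y)) -> f = g.
Proof.
apply: (@epi_sum _ _ _ _ (fun h => hc_pr B X h ⊠ idm Y)).
have [_ _ D] := hc_dsum B X.
rewrite -tenm1 -D tenm_suml; apply: eq_bigr => h _.
by rewrite -tenmM cmp1m.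
Qed.

Lemma hc_epi_l (W X Y Z : C) (f g : hom (W ⊗ (X ⊗ Y)) Z) :
  (forall h, f ∘ (idm W ⊠ (hc_in B X h ⊠ idm Y))
    = g ∘ (idm W ⊠ (hc_in B X h ⊠ idm Y))) -> f = g.
Proof.
apply: (@epi_sum _ _ _ _ (fun h => idm W ⊠ (hc_pr B X h ⊠ idm Y))).
have [_ _ D] := hc_dsum B X.
rewrite -!tenm1 -D tenm_suml tenm_sumr; apply: eq_bigr => h _.
by rewrite -!tenmM !cmp1m.
Qed.

Lemma hc_epi_r (X Y W Z : C) (f g : hom ((X ⊗ Y) ⊗ W) Z) :
  (forall h, f ∘ ((hc_in B X h ⊠ idm Y) ⊠ idm W)
    = g ∘ ((hc_in B X h ⊠ idm Y) ⊠ idm W)) -> f = g.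
Proof.
apply: (@epi_sum _ _ _ _ (fun h => (hc_pr B X h ⊠ idm Y) ⊠ idm W)).
have [_ _ D] := hc_dsum B X.
rewrite -!tenm1 -D !tenm_suml; apply: eq_bigr => h _.
by rewrite -!tenmM !cmp1m.
Qed.

Lemma gam_epi g (X Y Z : C) (f f' : hom (T g (X ⊗ Y)) Z) :
  (forall h, f ∘ gam A g (hc_in B X h ⊠ idm Y)
    = f' ∘ gam A g (hc_in B X h ⊠ idm Y)) -> f = f'.
Proof.
apply: (@epi_sum _ _ _ _ (fun h => gam A g (hc_pr B X h ⊠ idm Y))).
have [_ _ D] := hc_dsum B X.
rewrite -gam1 -tenm1 -D tenm_suml gam_sum; apply: eq_bigr => h _.
by rewrite -gamM -tenmM cmp1m.
Qed.

Lemma cbr_iso (X : C) Y : isiso (cbr X Y).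
Proof.
have [d [E cE]] : exists d : forall h,
    hom (T h (eqbase Y) ⊗ hc B h X) (hc B h X ⊗ eqbase Y),
    (forall h, cr B h (hc B h X) (eqbase Y) ∘ d h = idm _) /\
    (forall h, d h ∘ cr B h (hc B h X) (eqbase Y) = idm _).
  have [d dP] := fin_all_exists (fun h => cr_iso (eqbase Y) (hc_deg B h X)).
  by exists d; split=> h; case: (dP h).
have [v [V1 V2]] : exists v : forall h, hom (eqbase Y) (T h (eqbase Y)),
    (forall h, eqlift Y h ∘ v h = idm _) /\ (forall h, v h ∘ eqlift Y h = idm _).
  exists (fam_inv (eqlift Y)).
  by split=> h; [exact: eqlift_invr | exact: eqlift_invl].
have [P Q D] := hc_dsum B X.
exists (\sum_h (hc_in B X h ⊠ idm (eqbase Y)) ∘ d h ∘ (v h ⊠ hc_pr B X h)); split.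
  rewrite cmp_sumr -tenm1 -D tenm_sumr; apply: eq_bigr => h _.
  rewrite !cmpA (cbrE _ _ (hc_deg B h X)) -(cmpA _ (cr _ _ _ _)) E cmpm1.
  by rewrite -tenmM V1.
apply: hc_epi => l; rewrite -cmpA (cbrE _ _ (hc_deg B l X)) cmp1m cmp_suml.
rewrite (bigD1 l) //= big1 ?addr0 => [|h n]; last first.
  by rewrite -!cmpA (cmpA (v h ⊠ _)) -tenmM Q // tenm0r cmp0m !cmpm0.
rewrite -!cmpA (cmpA (v l ⊠ _)) -tenmM P V2 tenm1 cmp1m cE.
by rewrite cmpm1.
Qed.

Fact eq_br_def X Y h : cbr (eqbase X) Y ∘ eqlift (eq_ten X Y) h
  = eqlift (eq_ten Y X) h ∘ gam A h (cbr (eqbase X) Y).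
Proof.
apply: gam_epi => l; rewrite /= /ten_lift.
rewrite -!cmpA -gamM (cbrE _ _ (hc_deg B l _)) gaJ_nat gam1.
rewrite (cmpA (_ ⊠ _) (_ ⊠ _)) -tenmM cmpm1.
rewrite (tenm_split (_ ∘ _)) -!cmpA (cmpA (cbr _ _)).
have dT := deg_act h (hc_deg B l (eqbase X)).
rewrite (cbrE _ _ dT) -!cmpA (cmpA (cr _ _ _ _)) cr_nat //.
rewrite -!cmpA (cmpA (_ ⊠ _) (_ ⊠ _)) -tenmM cmpm1 -eqliftM.
rewrite gamM (cmpA (gaJ _ _ _ _)) gaJ_nat -!cmpA (cmpA (_ ⊠ _) (_ ⊠ _)).
rewrite -tenmM -eqliftM -(fam_cast (eqlift Y) (mulgKV h (h * l)%g)).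
rewrite -[X in _ = (_ ⊠ X) ∘ _]cmpm1 -[X in (_ ⊠ X) ∘ _ = _]cmpm1 -(cmpA (eqlift Y _)).
rewrite !(tenmM (eqlift Y (h * l)%g)) -!cmpA; congr (_ ∘ _).
have := cr_act h (eqbase Y) (hc_deg B l (eqbase X)).
by rewrite -!cmpA => ->.
Qed.

Fact cbr_nat X X' Y Y' (f : hom (eqbase X) (eqbase X')) (g : subvs_of (eqhom Y Y')) :
  cbr (eqbase X') Y' ∘ (f ⊠ vsval g) = (vsval g ⊠ f) ∘ cbr (eqbase X) Y.
Proof.
apply: hc_epi => h; have dX := hc_deg B h (eqbase X).
rewrite -!cmpA (cbrE _ _ dX) -tenmM cmpm1 tenm_split cmpA (cbrE _ _ dX).
rewrite -cmpA cr_nat // !cmpA -!tenmM cmpm1.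
by rewrite eqhomE.
Qed.

Fact cbr_hex1 X Y Z :
  ass (eqbase Y) (eqbase Z) (eqbase X) ∘ cbr (eqbase X) (eq_ten Y Z)
    ∘ ass (eqbase X) (eqbase Y) (eqbase Z)
  = (idm (eqbase Y) ⊠ cbr (eqbase X) Z) ∘ ass (eqbase Y) (eqbase X) (eqbase Z)
    ∘ (cbr (eqbase X) Y ⊠ idm (eqbase Z)).
Proof.
apply: hc_epi_r => h; have dX := hc_deg B h (eqbase X).
rewrite -!cmpA ass_nat tenm1 (cmpA (cbr _ _)) (cbrE _ (eq_ten Y Z) dX).
rewrite -!tenmM cmp1m (cbrE _ _ dX) tenmMl (cmpA (ass _ _ _) (_ ⊠ _)) ass_nat.
rewrite -!cmpA (cmpA (_ ⊠ _) (_ ⊠ _)) -tenmM cmp1m (cbrE _ _ dX).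
rewrite /= /ten_lift -[hc_in _ _ _ in LHS]cmpm1 tenmM.
rewrite -!cmpA (cmpA (ass _ _ _)) ass_nat -[eqlift Y h in RHS]cmpm1.
rewrite (tenmM (eqlift Y h)) -!cmpA; congr (_ ∘ _).
have := cr_hex1 (eqbase Y) (eqbase Z) dX.
by rewrite -!cmpA.
Qed.

Fact cbr_hex2 X Y Z :
  assi (eqbase Z) (eqbase X) (eqbase Y) ∘ cbr (eqbase X ⊗ eqbase Y) Z
    ∘ assi (eqbase X) (eqbase Y) (eqbase Z)
  = (cbr (eqbase X) Z ⊠ idm (eqbase Y)) ∘ assi (eqbase X) (eqbase Z) (eqbase Y)
    ∘ (idm (eqbase X) ⊠ cbr (eqbase Y) Z).
Proof.
apply: hc_epi => h; apply: hc_epi_l => l.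
have dX := hc_deg B h (eqbase X); have dY := hc_deg B l (eqbase Y).
rewrite -!cmpA -!tenmM !(cmp1m, cmpm1) (cbrE _ _ dY) assi_nat.
rewrite (cmpA (cbr _ _)) (cbrE _ _ (deg_ten dX dY)) -cmpA.
rewrite (cmpA (assi _ _ _)) assi_nat -[hc_in B _ h in RHS]cmpm1.
rewrite (tenmM (hc_in B _ h)).
rewrite (cmpA (assi _ _ _) (_ ⊠ _)) assi_nat -!cmpA (cmpA (_ ⊠ _) (_ ⊠ _)) -tenmM.
rewrite (tenm_split (hc_in B _ h)) (cmpA (cbr _ _)) (cbrE _ _ dX).
rewrite -(cmpA _ (cr _ _ _ _)) cr_nat // (cmpA _ _ (cr _ _ _ _)) -tenmM.
rewrite -eqliftM cmpm1 cmp1m.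
have E : (eqlift Z (h * l)%g ∘ gaM A h l (eqbase Z)) ⊠ hc_in B (eqbase X) h
  = (eqlift Z (h * l)%g ⊠ hc_in B (eqbase X) h) ∘ (gaM A h l (eqbase Z) ⊠ idm _).
  by rewrite -tenmM cmpm1.
rewrite E -cmpA -[hc_in B _ l in RHS]cmpm1 (tenmM (_ ⊠ _)) -cmpA.
congr (_ ∘ _); have := cr_hex2 (eqbase Z) dX dY.
by rewrite -!cmpA.
Qed.

Program Definition equivariantization : brcat k := {|
  bbase := eq_pivcat C;
  br X Y := @eqmk _ _ _ (eq_ten X Y) (eq_ten Y X) _ (@eq_br_def X Y) |}.
Next Obligation. by move=> *; apply: eq_isiso; apply: cbr_iso. Qed.
Next Obligation. by move=> *; apply: subvs_inj; apply: cbr_nat. Qed.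
Next Obligation. by move=> *; apply: subvs_inj; apply: cbr_hex1. Qed.
Next Obligation. by move=> *; apply: subvs_inj; apply: cbr_hex2. Qed.

End EqBraiding.

Record gchar (k : fieldType) (G : finGroupType) := GChar {
  gchr :> G -> k;
  gchr1 : gchr 1%g = 1;
  gchrM : forall h l, gchr (h * l)%g = gchr h * gchr l }.

Definition Smatrix (k : fieldType) (B : brcat k) n (F : 'I_n -> B) : 'M[k]_n :=
  \matrix_(i, j) Sentry (F i) (F j).

Section Statement.
Variables (k : fieldType) (G : finGroupType) (C : crossedcat k G).
Let CG := equivariantization C.

Definition Xchar (a : gchar k G) : CG :=
  EqObj (one_lift_iso C (gchr1 a) (gchrM a)) (one_liftM C (gchr1 a) (gchrM a)).

(* The component of degree h of the equivariantization. *)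
Definition eqdeg (h : G) (X : CG) :=
  forall a, br X (Xchar a) ∘ br (Xchar a) X = a h *: idm (Xchar a ⊗ X).

Definition trivial_stab (X : CG) :=
  forall a, iso (Xchar a ⊗ X) X -> forall h, a h = 1.

(* F lists, without repetition, representatives of the orbits of the group of
   characters on the isomorphism classes of objects in P. *)
Definition orbit_reps (P : CG -> Prop) n (F : 'I_n -> CG) :=
  (forall i, P (F i)) /\
  forall X, P X -> exists! i, exists a, iso X (Xchar a ⊗ F i).

(* Entries of S_(1,g), for X of degree 1 with its lifting and Y of degree g.
   The braiding X ⊗ Y -> T_1(Y) ⊗ X is followed by T_1(Y) = Y, and the
   isomorphism T_g(X) -> X is the one of the lifting. *)
Definition crossedS (g : G) (X : eqobj C) (Y : C) : k :=
  trR ((eqlift X g ⊠ idm Y) ∘ cr (xcr C) g Y (eqbase X)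
       ∘ ((gaE (xact C) Y ⊠ idm (eqbase X)) ∘ cr (xcr C) 1%g (eqbase X) Y)).

Definition crossedS_mx (g : G) m n (X : 'I_m -> eqobj C) (Y : 'I_n -> C) :
    'M[k]_(m, n) :=
  \matrix_(i, j) crossedS g (X i) (Y j).

End Statement.

(* Main.v *)
Require Import Defs.
From HB Require Import structures.
From mathcomp Require Import all_boot all_order all_algebra all_fingroup.
From mathcomp Require Import cyclic separable cyclotomic.
Import Defs.
Set Implicit Arguments.
Unset Strict Implicit.
Unset Printing Implicit Defensive.
Import GRing.Theory.
Local Open Scope ring_scope.

(** The characters of the cyclic group G separate its elements, so that an
    equivariant object has degree h for the grading of the equivariantization,
    defined by double braidings with characters, iff its underlying object has
    degree h.  For equivariant X and Y, averaging over G splits Hom_C(X, Y) into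
    the spaces Hom(X_a ⊗ X, Y) for a in the dual of G.  By Schur's lemma,
    - liftings of the same simple object differ by a character;
    - an equivariant simple object with trivial stabilizer has only scalar
      endomorphisms in C, hence a simple underlying object;
    - an equivariant simple object of degree g is a twist of any lifting of a
      simple summand of its underlying object.
    A simple X with T_g X ≅ X has a lifting because G is cyclic: an isomorphism
    u : T_g X -> X has all powers T_(g^j) X -> X, and can be rescaled so that
    its power of exponent #|G| is the canonical T_1 X ≅ X.  The condition holds
    for every simple Y of degree g by means of the crossed braiding of Y with
    its dual.  The equality of matrix entries is then the definition of the
    braiding on homogeneous components. *)

(** * Isomorphisms, monomorphisms and simple objects in linear categories *)

Section LinCatTheory.
Variables (k : fieldType) (C : lincat k).
Implicit Types X Y Z : C.

Lemma cmpBr X Y Z (f : hom Y Z) (g g' : hom X Y) : f ∘ (g - g') = f ∘ g - f ∘ g'.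
Proof. by rewrite cmpDr -[- g']scaleN1r cmpZr scaleN1r. Qed.

Lemma cmpBl X Y Z (f f' : hom Y Z) (g : hom X Y) : (f - f') ∘ g = f ∘ g - f' ∘ g.
Proof. by rewrite cmpDl -[- f']scaleN1r cmpZl scaleN1r. Qed.

Lemma cancel0l X Y Z (f : hom X Y) (a : hom Z X) : isiso f -> f ∘ a = 0 -> a = 0.
Proof. by case=> f' [_ E] H; apply: (cancell E); rewrite H cmpm0. Qed.

Lemma cancel0r X Y Z (f : hom X Y) (a : hom Y Z) : isiso f -> a ∘ f = 0 -> a = 0.
Proof. by case=> f' [E _] H; apply: (cancelr E); rewrite H cmp0m. Qed.

Lemma isiso_idm X : isiso (idm X).
Proof. by exists (idm X); split; rewrite cmp1m. Qed.

Lemma isiso_cmp X Y Z (g : hom Y Z) (f : hom X Y) :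
  isiso g -> isiso f -> isiso (g ∘ f).
Proof.
move=> [g' [g1 g2]] [f' [f1 f2]]; exists (f' ∘ g'); split.
  by rewrite -cmpA (cmpA f) f1 cmp1m.
by rewrite -cmpA (cmpA g') g2 cmp1m.
Qed.

Lemma isiso_inv X Y (f : hom X Y) g : inverses f g -> isiso g.
Proof. by case=> E E'; exists f; split. Qed.

Lemma iso_sym X Y : iso X Y -> iso Y X.
Proof. by case=> f [g I]; exists g; exact: isiso_inv I. Qed.

Lemma iso_trans X Y Z : iso X Y -> iso Y Z -> iso X Z.
Proof. by case=> f If [g Ig]; exists (g ∘ f); exact: isiso_cmp. Qed.

Lemma iso_mono X Y (f : hom X Y) : isiso f -> mono f.
Proof. by case=> g [_ E] Z a b; exact: cancell E. Qed.

Lemma mono_cmp X Y Z (g : hom Y Z) (f : hom X Y) : mono g -> mono f -> mono (g ∘ f).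
Proof. by move=> mg mf W a b; rewrite -!cmpA => /mg /mf. Qed.

Lemma mono0P X Y (f : hom X Y) :
  mono f <-> forall Z (a : hom Z X), f ∘ a = 0 -> a = 0.
Proof.
split=> [m Z a E|H Z a b E]; first by apply: m; rewrite E cmpm0.
by apply/eqP; rewrite -subr_eq0; apply/eqP/H; rewrite cmpBr E subrr.
Qed.

Lemma isiso_neq0 X Y (f : hom X Y) : idm X <> 0 -> isiso f -> f <> 0.
Proof. by move=> n [g [_ E]] f0; apply: n; rewrite -E f0 cmpm0. Qed.

Lemma simple_iso X Y : iso X Y -> simple X -> simple Y.
Proof.
case=> f [g I] [n S]; have isog := isiso_inv I; case: (I) => fg gf.
split=> [y0|Z h mh].
  by apply: n; rewrite -gf -[f]cmp1m y0 cmp0m cmpm0.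
have /S[] : mono (g ∘ h) by apply: mono_cmp => //; apply: iso_mono.
  by move/(cancel0l isog); left.
move=> i; right; rewrite -[h]cmp1m -fg -cmpA.
by apply: isiso_cmp => //; exists g.
Qed.

Definition has_kernels :=
  forall X Y (f : hom X Y), exists K (i : hom K X), is_kernel f i.

Lemma kernel_mono X Y K (f : hom X Y) (i : hom K X) : is_kernel f i -> mono i.
Proof.
case=> f0 u Z a b E; case: (u Z (i ∘ b)) => [|w [_ U]].
  by rewrite cmpA f0 cmp0m.
by rewrite -(U a E) (U b erefl).
Qed.

Definition End_scalar X := idm X <> 0 /\ forall f : hom X X, exists a, f = a *: idm X.

(** For a simple summand of X, the idempotent [i a0 ∘ p a0] is a scalar c that fixes the summand.
    Hence c = 1 and X is that summand. *)
Lemma End_scalar_simple X : semisimple C -> End_scalar X -> simple X.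
Proof.
move=> ss [n S]; have [m [F [i [p [sF [pi pi0 D]]]]]] := ss X.
have [a0 _|E] := pickP 'I_m; last first.
  by case: n; rewrite -D big1 // => a; have:= E a.
have [c Ec] := S (i a0 ∘ p a0).
have E1 : c *: idm (F a0) = idm (F a0).
  rewrite -{2}[idm _]cmp1m -{2 3}(pi a0) cmpA -(cmpA (p a0)) Ec.
  by rewrite cmpZr cmpm1 cmpZl pi.
have c1 : c = 1.
  apply/eqP; rewrite -subr_eq0; apply/eqP; have [//|c1] := eqVneq (c - 1) 0.
  have [[]] := sF a0; apply: (scalerI c1).
  by rewrite scaler0 scalerBl E1 scale1r subrr.
apply: simple_iso (sF a0); exists (i a0), (p a0); split=> //.
by rewrite Ec c1 scale1r.
Qed.

End LinCatTheory.

(** * Schur's lemma over an algebraically closed field *)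

HB.instance Definition _ (k : fieldType) (C : lincat k) (X Y Z : C) (f : hom Y Z) :=
  GRing.isLinear.Build k (hom X Y) (hom X Z) _ (cmp f)
    (fun a u v => cmp_linr a f u v).

Section Schur.
Import VectorInternalTheory.
Variables (k : closedFieldType) (C : lincat k).
Hypothesis ker : has_kernels C.
Implicit Types X Y Z : C.

(** The kernel of [f] is a subobject of X, hence 0 or all of X. The latter would give f = 0, so [f]
    is mono and Y being simple applies. *)
Lemma Schur_iso X Y (f : hom X Y) : simple X -> simple Y -> f <> 0 -> isiso f.
Proof.
move=> [nX sX] [nY sY] nf; have [K [i ki]] := ker f.
have [fi u] := ki; case: (sY X f) => //; apply/mono0P => Z z fz.
have [w [<- _]] := u Z z fz.
case: (sX K i (kernel_mono ki)) => [->|ii]; first by rewrite cmp0m.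
by case: nf; apply: cancel0r ii fi.
Qed.

(** Composition with [f] on the finite-dimensional space End(X) has an eigenvector w, for an
    eigenvalue a. As f - a kills w, it is not invertible, hence zero. *)
Lemma Schur_scalar X : simple X -> End_scalar X.
Proof.
move=> sX; have [nX _] := sX; split=> // f.
pose A := lin1_mx (v2r \o (fun v : hom X X => f ∘ v) \o r2v).
have [a ra] : exists a, root (char_poly A) a.
  (* The characteristic polynomial is not constant, because End(X) contains [idm X] <> 0. *)
  apply/closed_rootP; rewrite size_char_poly eqSS.
  apply: contra_not_neq nX => d0; apply: v2r_inj.
  by apply/matrixP => i j; case: j => j lj; exfalso; rewrite d0 in lj.
move: ra; rewrite -eigenvalue_root_char => /eigenvalueP[v Ev nv].
pose w := r2v v; have fw : (f - a *: idm X) ∘ w = 0.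
  rewrite cmpBl cmpZl cmp1m; apply/eqP; rewrite subr_eq0; apply/eqP.
  apply: v2r_inj; rewrite linearZ /= r2vK -Ev mul_rV_lin1.
  by [].
exists a; apply/eqP; rewrite -subr_eq0; apply: contraT => /eqP ng.
have w0 := cancel0l (Schur_iso sX sX ng) fw.
by case/eqP: nv; rewrite -[v]r2vK -/w w0 linear0.
Qed.

End Schur.

(** * Scalars in tensor products, and the braiding with the unit object *)

Lemma tenmZl (k : fieldType) (C : moncat k) (X X' Y Y' : C) a
    (f : hom X X') (g : hom Y Y') : (a *: f) ⊠ g = a *: (f ⊠ g).
Proof. by rewrite -[a *: f]addr0 tenm_linl tenm0l addr0. Qed.

Lemma tenmZr (k : fieldType) (C : moncat k) (X X' Y Y' : C) a
    (f : hom X X') (g : hom Y Y') : f ⊠ (a *: g) = a *: (f ⊠ g).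
Proof. by rewrite -[a *: g]addr0 tenm_linr tenm0r addr0. Qed.

Section BraidUnit.
Variables (k : fieldType) (B : brcat k).
Implicit Types X Y Z : B.

Lemma lun_iso X : isiso (lun X).
Proof. by exists (luni X); exact: lunK. Qed.

Lemma run_iso X : isiso (run X).
Proof. by exists (runi X); exact: runK. Qed.

(** With b = [lun X ∘ br X one], the hexagon for X, 1, 1 composed with left unitors reads b ∘ (b ⊠
    id) = b ∘ (run X ⊠ id), and b is invertible. *)
Lemma lun_br X : lun X ∘ br X one = run X.
Proof.
apply: run_faithful.
have [b [_ b2]] : isiso (lun X ∘ br X one) by apply: isiso_cmp (lun_iso X) (br_iso _ _).
apply: (cancell b2); rewrite tenmMl.
have H := br_hex1 X (one : B) one.
have := congr1 (fun f => lun X ∘ ((idm one ⊠ lun X) ∘ f)) H.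
rewrite -!cmpA (cmpA (_ ⊠ lun X) (_ ⊠ br _ _)) -tenmMr (cmpA (lun X) (_ ⊠ (_ ∘ _))).
rewrite lun_nat -!cmpA (cmpA (lun (_ ⊗ _))) lun_ten.
move=> <-; rewrite (cmpA (lun X) (_ ⊠ lun X)) lun_nat -!cmpA.
rewrite (cmpA (lun (_ ⊗ _))) lun_ten (cmpA (lun one ⊠ _)).
rewrite -br_nat -!cmpA; do 2 congr (_ ∘ _).
by rewrite triangle.
Qed.

Lemma run_br X : run X ∘ br one X = lun X.
Proof.
apply: lun_faithful.
have [b [_ b2]] : isiso (run X ∘ br one X) by apply: isiso_cmp (run_iso X) (br_iso _ _).
apply: (cancell b2); rewrite tenmMr.
have H := br_hex2 (one : B) one X.
have := congr1 (fun f => run X ∘ ((run X ⊠ idm one) ∘ f)) H.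
rewrite -!cmpA (cmpA (run X ⊠ _) (br _ _ ⊠ _)) -tenmMl (cmpA (run X) ((_ ∘ _) ⊠ _)).
have rt Y Z : run (Y ⊗ Z) ∘ assi Y Z one = idm Y ⊠ run Z.
  by rewrite -run_ten -cmpA (assK _ _ _).1 cmpm1.
rewrite run_nat -!cmpA (cmpA (run (_ ⊗ _))) rt.
move=> <-; rewrite (cmpA (run X) (run X ⊠ _)) run_nat -!cmpA.
rewrite (cmpA (run (_ ⊗ _))) rt (cmpA (_ ⊠ run one)).
rewrite -br_nat -!cmpA; do 2 congr (_ ∘ _).
by rewrite -triangle -cmpA (assK _ _ _).1 cmpm1.
Qed.

Lemma br_unitK X : br X one ∘ br one X = idm (one ⊗ X).
Proof.
apply: (cancell (lunK X).2).
by rewrite cmpA lun_br run_br cmpm1.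
Qed.

End BraidUnit.

(** * Characters of a finite cyclic group and their orthogonality *)

Section Characters.

Lemma pchar0_natr_neq0 (R : idomainType) n :
  [pchar R] =i pred0 -> (0 < n)%N -> n%:R != 0 :> R.
Proof.
move=> ch0 n0; rewrite natf_neq0_pchar; apply/pnatP => // p _ _.
by rewrite inE /= ch0.
Qed.

(** In characteristic 0 the polynomial X^n - 1 is separable, so it has n distinct roots, and n
    distinct n-th roots of unity include a primitive one. *)
Lemma prim_root_exists (k : closedFieldType) n :
  [pchar k] =i pred0 -> (0 < n)%N -> exists z : k, n.-primitive_root z.
Proof.
move=> ch0 n0; have n1 := pchar0_natr_neq0 ch0 n0.
have [r Er] := closed_field_poly_normal ('X^n - 1 : {poly k}).
rewrite lead_coefXnsubC // scale1r in Er.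
have sr : size r = n.
  by apply: succn_inj; rewrite -(size_prod_XsubC r id) -Er size_XnsubC.
have ur : uniq r by rewrite -separable_prod_XsubC -Er separable_Xn_sub_1.
have /hasP[z _ pz] : has n.-primitive_root r.
  apply: has_prim_root; rewrite ?sr //; apply/allP => z zr.
  by move: zr; rewrite -(root_prod_XsubC r) -Er.
by exists z.
Qed.

(** The i-th character sends g^j to z^(ij), for z a primitive root of unity of order #|G|. The sum
    over i is geometric, with a ratio x <> 1 such that x^#|G| = 1. *)
Lemma cyclic_characters (k : closedFieldType) (G : finGroupType) (g : G) :
  [pchar k] =i pred0 -> generator [set: G] g ->
  exists a : 'I_#|G| -> gchar k G, forall h, h != 1%g -> \sum_i a i h = 0.
Proof.
move=> ch0 gen; have oG : #[g]%g = #|G| by rewrite /order -(eqP gen) cardsT.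
have n0 : (0 < #|G|)%N by rewrite -oG.
have [z pz] := prim_root_exists ch0 n0.
have [log logE] : exists log : G -> nat, forall h, (g ^+ log h)%g = h.
  apply: (@fin_all_exists G (fun=> nat) (fun h j => (g ^+ j)%g = h)) => h; have /cycleP[j ->] : h \in <[g]>%g.
    by rewrite -(eqP gen) inE.
  by exists j.
have zE i j : (g ^+ i)%g = (g ^+ j)%g -> z ^+ i = z ^+ j.
  move/eqP; rewrite eq_expg_mod_order oG => E.
  by apply/eqP; rewrite (eq_prim_root_expr pz).
pose x h := z ^+ log h.
have x1 : x 1%g = 1 by apply: (zE _ 0%N); rewrite logE.
have xM h l : x (h * l)%g = x h * x l.
  by rewrite -exprD; apply: zE; rewrite expgD !logE.
have a1 i : x 1%g ^+ i = 1 by rewrite x1 expr1n.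
have aM i h l : x (h * l)%g ^+ i = x h ^+ i * x l ^+ i by rewrite xM exprMn.
exists (fun i : 'I_#|G| => GChar (a1 i) (aM i)) => h nh /=.
have nx : x h - 1 != 0.
  rewrite subr_eq0; apply: contra nh; rewrite -(expr0 z) (eq_prim_root_expr pz).
  by rewrite -oG -eq_expg_mod_order logE.
apply: (mulfI nx); rewrite mulr0 -subrX1 -exprM mulnC exprM.
by rewrite (prim_expr_order pz) expr1n subrr.
Qed.

Fact chinv1 (k : fieldType) (G : finGroupType) (a : gchar k G) : a 1^-1%g = 1.
Proof. by rewrite invg1 gchr1. Qed.

Fact chinvM (k : fieldType) (G : finGroupType) (a : gchar k G) h l :
  a (h * l)^-1%g = a h^-1%g * a l^-1%g.
Proof. by rewrite invMg gchrM mulrC. Qed.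

Definition chinv (k : fieldType) (G : finGroupType) (a : gchar k G) : gchar k G :=
  GChar (chinv1 a) (chinvM a).

Lemma chinvK (k : fieldType) (G : finGroupType) (a : gchar k G) h : a h * a h^-1%g = 1.
Proof. by rewrite -gchrM mulgV gchr1. Qed.

End Characters.

(** * Kernels, monomorphisms and simple objects of the equivariantization *)

Section EqTheory.
Variables (k : fieldType) (G : finGroupType) (C : crossedcat k G).
Local Notation A := (xact C).
Local Notation T := (ga A).
Local Notation CG := (equivariantization C).
Implicit Types (X Y Z : eqobj C) (h l : G).

Lemma eq_inversesE X Y (f : @hom k CG X Y) (g : @hom k CG Y X) :
  inverses f g -> inverses (vsval f) (vsval g).
Proof. by case=> E E'; split; [move/(congr1 vsval): E | move/(congr1 vsval): E']. Qed.

Lemma eq_isisoE X Y (f : @hom k CG X Y) : isiso f <-> isiso (vsval f).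
Proof.
split; last exact: eq_isiso.
by case=> g /eq_inversesE I; exists (vsval g).
Qed.

Lemma eq_iso_base X Y : @iso k CG X Y -> iso (eqbase X) (eqbase Y).
Proof. by case=> f /eq_isisoE i; exists (vsval f). Qed.

Lemma eq_neq0 X Y (f : @hom k CG X Y) : f = 0 <-> vsval f = 0.
Proof. by split=> [->|E] //; apply: subvs_inj. Qed.

(** The kernel property yields each [w h]. Since [i] is mono, the lifting identities for [w] follow
    from those of X, and [fam_iso] makes [w h] invertible. *)
Lemma mono_lift (X Y : eqobj C) (K : C) (i : hom K (eqbase X))
    (f : hom (eqbase X) (eqbase Y)) :
  (forall h, f ∘ eqlift X h = eqlift Y h ∘ gam A h f) -> is_kernel f i ->
  exists w : forall h, hom (T h K) K,
    [/\ forall h, i ∘ w h = eqlift X h ∘ gam A h i,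
        forall h l, w (h * l)%g ∘ gaM A h l K = w h ∘ gam A h (w l)
      & forall h, isiso (w h)].
Proof.
move=> fe ki; have mi := kernel_mono ki; have [fi u] := ki.
have [h|w wE] := @fin_all_exists G (fun h => hom (T h K) K)
    (fun h v => i ∘ v = eqlift X h ∘ gam A h i).
  have [|v [E _]] := u _ (eqlift X h ∘ gam A h i); last by exists v.
  by rewrite cmpA fe -cmpA -gamM fi gam0 cmpm0.
have wM h l : w (h * l)%g ∘ gaM A h l K = w h ∘ gam A h (w l).
  apply: mi; rewrite !cmpA !wE -!cmpA -gaM_nat cmpA eqliftM -!cmpA -!gamM.
  by rewrite wE.
exists w; split=> //; apply: fam_iso wM _; apply: mi.
by rewrite wE eqlift1 gaE_nat.
Qed.

Lemma eq_kernels : abelian_cat C -> has_kernels CG.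
Proof.
move=> ab X Y f; have [K [i ki]] := ab_ker ab (vsval f).
have [w [wE wM wi]] := mono_lift (eqhomE f) ki.
have mi := kernel_mono ki; have [fi u] := ki.
pose K' : CG := EqObj wi wM.
exists K', (@eqmk _ _ _ K' X i wE); split; first exact: subvs_inj.
move=> Z z /eq_neq0 fz; have [v [Ev Uv]] := u _ _ fz.
have Hv h : v ∘ eqlift Z h = eqlift K' h ∘ gam A h v.
  by apply: mi; rewrite !cmpA Ev wE eqhomE -cmpA -gamM Ev.
exists (@eqmk _ _ _ Z K' v Hv); split; first exact: subvs_inj.
by move=> v' E; apply: subvs_inj; apply: Uv; rewrite -E.
Qed.

(** The kernel of the underlying morphism carries a lifting that makes its inclusion equivariant, so
    an equivariant mono forces this inclusion to vanish. *)
Lemma eq_monoE X Y (f : @hom k CG X Y) :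
  abelian_cat C -> mono f <-> mono (vsval f).
Proof.
move=> ab; split=> m; last first.
  by move=> Z a b E; apply/subvs_inj/m; move/(congr1 vsval): E.
have [K [i ki]] := ab_ker ab (vsval f).
have [w [wE wM wi]] := mono_lift (eqhomE f) ki.
have [fi u] := ki; pose K' : CG := EqObj wi wM.
have i0 : i = 0.
  suff : @eqmk _ _ _ K' X i wE = 0 :> @hom k CG K' X by move/eq_neq0.
  by apply: (proj1 (mono0P f) m); apply: subvs_inj.
apply/mono0P => Z a /u[v [<- _]].
by rewrite i0 cmp0m.
Qed.

Lemma eq_simple_base X : abelian_cat C -> simple (eqbase X) -> @simple k CG X.
Proof.
move=> ab [n S]; split=> [/eq_neq0 //|Y f /(eq_monoE f ab)/S[]].
  by move/eq_neq0; left.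
by move/eq_isisoE; right.
Qed.

End EqTheory.

(** * Twists by characters, and the isotypic decomposition of Hom spaces *)

Section Semi.
Variables (k : fieldType) (G : finGroupType) (C : crossedcat k G).
Local Notation A := (xact C).
Local Notation T := (ga A).
Local Notation CG := (equivariantization C).
Implicit Types (X Y Z : eqobj C) (a b : gchar k G) (h l : G).

Fact twist_liftM a X h l :
  (a (h * l)%g *: eqlift X (h * l)%g) ∘ gaM A h l (eqbase X)
  = (a h *: eqlift X h) ∘ gam A h (a l *: eqlift X l).
Proof. by rewrite gamZ cmpZr !cmpZl scalerA eqliftM gchrM mulrC. Qed.

Fact twist_lift_iso a X h : isiso (a h *: eqlift X h).
Proof.
apply: (fam_iso (twist_liftM a X)).
by rewrite gchr1 scale1r eqlift1.
Qed.

(* Up to isomorphism this is tensoring with [Xchar a], see [Xchar_twist]. *)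
Definition twist a X : eqobj C := EqObj (twist_lift_iso a X) (twist_liftM a X).

Lemma Xchar_twist a X : @iso k CG (Xchar C a ⊗ X) (twist a X).
Proof.
have H h : lun (eqbase X) ∘ eqlift (eq_ten (Xchar C a) X) h
    = eqlift (twist a X) h ∘ gam A h (lun (eqbase X)).
  rewrite /= /ten_lift /= tenm_split' -ga_lun -!cmpA (cmpA (lun _)) lun_nat.
  by rewrite tenmZl !(cmpZl, cmpZr) -!cmpA.
exists (@eqmk _ _ _ (eq_ten (Xchar C a) X) (twist a X) _ H).
by apply/eq_isisoE => /=; exists (luni (eqbase X)); exact: lunK.
Qed.

(** Twisting the source by the inverse character turns a morphism into [twist a X] into a morphism
    into X with the same underlying morphism. *)
Lemma twist_simple a X : abelian_cat C -> @simple k CG X -> @simple k CG (twist a X).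
Proof.
move=> ab [n S]; split=> [/eq_neq0 /= n0|Y f mf].
  by apply: n; apply/eq_neq0.
pose Y' := twist (chinv a) Y.
have H h : vsval f ∘ eqlift Y' h = eqlift X h ∘ gam A h (vsval f).
  rewrite /= cmpZr; have /= -> := eqhomE f h.
  by rewrite cmpZl scalerA mulrC chinvK scale1r.
pose f' : @hom k CG Y' X := @eqmk _ _ _ Y' X _ H.
have /S[] : mono f' by apply/(eq_monoE f' ab)/(eq_monoE f ab).
  by move/eq_neq0 => E; left; apply/eq_neq0.
by move/eq_isisoE => E; right; apply/eq_isisoE.
Qed.

(** The action of G on Hom_C(X, Y) whose invariants are the equivariant morphisms. *)
Definition transport X Y h (f : hom (eqbase X) (eqbase Y)) :=
  eqlift Y h ∘ gam A h f ∘ fam_inv (eqlift X) h.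

Lemma transportE X Y h (f : hom (eqbase X) (eqbase Y)) :
  transport h f ∘ eqlift X h = eqlift Y h ∘ gam A h f.
Proof. by rewrite -cmpA eqlift_invl cmpm1. Qed.

Lemma transport1 X Y (f : hom (eqbase X) (eqbase Y)) : transport 1%g f = f.
Proof.
have [v [E _]] := eqlift_iso X 1%g; apply: (cancelr E).
by rewrite transportE !eqlift1 gaE_nat.
Qed.

Lemma transportM X Y h l (f : hom (eqbase X) (eqbase Y)) :
  transport h (transport l f) = transport (h * l)%g f.
Proof.
have [v [E _]] : isiso (eqlift X (h * l)%g ∘ gaM A h l (eqbase X)).
  by apply: cmp_iso; [exact: eqlift_iso | exists (gaMi A h l _); exact: gaMK].
apply: (cancelr E); rewrite {1}eqliftM !cmpA !transportE.
rewrite -!cmpA -gamM transportE gamM -gaM_nat !cmpA.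
by rewrite eqliftM.
Qed.

Lemma transport_sum X Y h (I : finType) (f : I -> hom (eqbase X) (eqbase Y)) c :
  transport h (\sum_i c i *: f i) = \sum_i c i *: transport h (f i).
Proof.
rewrite /transport gam_sum cmp_sumr cmp_suml; apply: eq_bigr => i _.
by rewrite gamZ cmpZr cmpZl.
Qed.

(** This is #|G| times the projection onto the isotypic component of the character [a]. *)
Definition proj_char X Y a (f : hom (eqbase X) (eqbase Y)) :=
  \sum_h a h^-1%g *: transport h f.

Lemma proj_charE X Y a (f : hom (eqbase X) (eqbase Y)) h :
  transport h (proj_char a f) = a h *: proj_char a f.
Proof.
rewrite transport_sum /proj_char scaler_sumr.
rewrite [RHS](reindex_inj (mulgI h)) /=; apply: eq_bigr => l _.
by rewrite transportM scalerA invMg gchrM mulrCA chinvK mulr1.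
Qed.

Fact proj_char_equiv X Y a (f : hom (eqbase X) (eqbase Y)) h :
  proj_char a f ∘ eqlift (twist a X) h = eqlift Y h ∘ gam A h (proj_char a f).
Proof. by rewrite -transportE proj_charE /= cmpZl cmpZr. Qed.

Definition proj_hom X Y a (f : hom (eqbase X) (eqbase Y)) : @hom k CG (twist a X) Y :=
  @eqmk _ _ _ (twist a X) Y _ (proj_char_equiv a f).

Lemma sum_proj_char X Y (f : hom (eqbase X) (eqbase Y)) (I : finType)
    (a : I -> gchar k G) : (forall h, h != 1%g -> \sum_i a i h = 0) ->
  \sum_i proj_char (a i) f = #|I|%:R *: f.
Proof.
move=> orth; rewrite exchange_big (bigD1 1%g) //= [X in _ + X]big1 ?addr0.
  rewrite transport1 -scaler_suml (eq_bigr (fun=> 1)) => [|i _].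
    by rewrite sumr_const.
  by rewrite invg1 gchr1.
by move=> h nh; rewrite -scaler_suml orth ?scale0r // invg_eq1.
Qed.

End Semi.

(** * Comparison of the grading by double braidings with the grading of C *)

Section Degrees.
Variables (k : fieldType) (G : finGroupType) (C : crossedcat k G).
Local Notation A := (xact C).
Local Notation B := (xcr C).
Local Notation T := (ga A).
Local Notation CG := (equivariantization C).
Implicit Types (h l : G).

Lemma hc_in0_deg h (X : C) : (forall l, l != h -> hc_in B X l = 0) -> deg B h X.
Proof.
move=> Z; apply: deg_iso (hc_deg B h X); have [P _ D] := hc_dsum B X.
exists (hc_in B X h), (hc_pr B X h); split=> //.
by rewrite -[RHS]D (bigD1 h) //= big1 ?addr0 // => l /Z ->; rewrite cmp0m.
Qed.

Lemma deg_retract h (X Y : C) (i : hom Y X) (p : hom X Y) :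
  p ∘ i = idm Y -> deg B h X -> deg B h Y.
Proof.
move=> pi dX; apply: hc_in0_deg => l nl.
rewrite -[hc_in _ _ _]cmp1m -pi -cmpA (_ : i ∘ _ = 0) ?cmpm0 //.
exact: deg_hom0 (hc_deg B l Y) dX nl.
Qed.

Lemma cbr_char l (Z X : C) (i : hom Z X) (a : gchar k G) : deg B l Z ->
  cbr X (Xchar C a) ∘ (i ⊠ idm one) = a l *: (cbr X (eq_one C) ∘ (i ⊠ idm one)).
Proof.
move=> dZ; rewrite (cbrE _ (Xchar C a) dZ) (cbrE _ (eq_one C) dZ) /=.
by rewrite tenmZl cmpZl.
Qed.

Lemma cbr_unitK (X : eqobj C) :
  cbr (eqbase X) (eq_one C) ∘ cbr one X = idm (one ⊗ eqbase X).
Proof. exact: (congr1 vsval (br_unitK (X : CG))). Qed.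

(** On the component of degree l, the double braiding with [Xchar C b] is the scalar b l. If X has
    degree h for the braiding, a character separating l from h kills the component of degree l. *)
Lemma eqdeg_deg (I : finType) (a : I -> gchar k G) h (X : eqobj C) :
  #|I|%:R != 0 :> k -> (forall l, l != 1%g -> \sum_i a i l = 0) ->
  eqdeg h X <-> deg B h (eqbase X).
Proof.
move=> nI orth; split=> [E|dX b]; last first.
  apply: subvs_inj => /=.
  have := @cbr_char h _ _ (idm (eqbase X)) b dX; rewrite !tenm1 !cmpm1 => ->.
  by rewrite cmpZl cbr_unitK.
apply: hc_in0_deg => l nlh.
(* Otherwise every a i (l h^-1) would be 1, and their sum would be #|I| instead of 0. *)
have [i ni] : exists i, a i l != a i h.
  apply/existsP; apply: contraNT nI; rewrite negb_exists => /forallP H.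
  rewrite -(orth (l * h^-1)%g) -?eq_mulgV1 // (eq_bigr (fun=> 1)).
    by rewrite sumr_const.
  by move=> i _; rewrite gchrM; have := H i; rewrite negbK => /eqP ->; rewrite chinvK.
(* The other half of the double braiding, [cbr one X], is the same for all characters and
   invertible, so it cancels. *)
have Ei : cbr (eqbase X) (Xchar C (a i)) = a i h *: cbr (eqbase X) (eq_one C).
  have [d [D _]] := cbr_iso one X; apply: (cancelr D).
  rewrite cmpZl cbr_unitK; exact: (congr1 vsval (E (a i))).
have := cbr_char (hc_in B (eqbase X) l) (a i) (hc_deg B l _).
rewrite Ei cmpZl => /eqP; rewrite eq_sym -subr_eq0 -scalerBl.
rewrite scaler_eq0 subr_eq0 (negPf ni) => /eqP/cancel0l H.
by apply: run_faithful; rewrite tenm0l; apply: H; apply: cbr_iso.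
Qed.

End Degrees.

(** * Duals and the group action preserve objects with scalar endomorphisms *)

Section CrossedFixed.
Variables (k : fieldType) (G : finGroupType) (C : crossedcat k G).
Local Notation A := (xact C).
Local Notation B := (xcr C).
Local Notation T := (ga A).
Implicit Types (X Y Z : C) (h l : G).

Lemma End_scalar_faithful X Y (F : hom Y Y -> hom X X) :
  injective F -> (forall c, F (c *: idm Y) = c *: idm X) ->
  End_scalar X -> End_scalar Y.
Proof.
move=> Fi FZ [n S]; split=> [Y0|f].
  by apply: n; rewrite -[LHS]scale1r -FZ scale1r Y0 -(scale0r (idm Y)) FZ scale0r.
by have [c Ec] := S (F f); exists c; apply: Fi; rewrite FZ.
Qed.

(** The pivotal structure conjugates the double dual of a morphism to the morphism itself. *)
Lemma dualm_inj X Y : injective (@dualm k C X Y).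
Proof.
move=> f f' E; have [p [_ pK]] := piv_iso Y.
by apply: (cancell pK); rewrite !piv_nat E.
Qed.

Lemma dualmZ X Y c (f : hom X Y) : dualm (c *: f) = c *: dualm f.
Proof.
by apply: ev_inj; rewrite ev_dualm tenmZl tenmZr !cmpZr ev_dualm.
Qed.

Lemma dual_iso X Y : iso X Y -> iso (dual Y) (dual X).
Proof.
case=> f [g [fg gf]]; exists (dualm f), (dualm g).
by split; rewrite -dualmM ?fg ?gf dualm1.
Qed.

Lemma bidual_iso X : iso X (dual (dual X)).
Proof. by exists (piv X); exact: piv_iso. Qed.

Lemma End_scalar_dual X : End_scalar X -> End_scalar (dual X).
Proof.
have [p [pK Kp]] := piv_iso X.
apply: (@End_scalar_faithful _ _ (fun f => p ∘ dualm f ∘ piv X)).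
  move=> f f' /(cancelr pK)/(cancell pK).
  exact: dualm_inj.
by move=> c; rewrite dualmZ dualm1 cmpZr cmpZl cmpm1 Kp.
Qed.

Lemma gam_cast h l (e : h = l) X Y (f : hom X Y) :
  acast T e Y ∘ gam A h f = gam A l f ∘ acast T e X.
Proof. by case: l / e; rewrite cmp1m cmpm1. Qed.

Definition gaVK h X : hom (T h^-1%g (T h X)) X :=
  gaE A X ∘ acast T (mulVg h) X ∘ gaM A h^-1 h X.

Lemma gaVK_nat h X Y (f : hom X Y) :
  gaVK h Y ∘ gam A h^-1 (gam A h f) = f ∘ gaVK h X.
Proof.
rewrite /gaVK -!cmpA gaM_nat (cmpA (acast _ _ _)) gam_cast -!cmpA.
by rewrite (cmpA (gaE _ _)) gaE_nat -!cmpA.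
Qed.

Lemma gaVK_iso h X : isiso (gaVK h X).
Proof.
apply: isiso_cmp; last by exists (gaMi A _ _ _); exact: gaMK.
apply: isiso_cmp; first by exists (gaEi A X); exact: gaEK.
by case: _ / (mulVg h); exact: isiso_idm.
Qed.

Lemma gam_inj h X Y : injective (@gam _ _ _ A h X Y).
Proof.
move=> f f' E; have [v [vK _]] := gaVK_iso h X.
by apply: (cancelr vK); rewrite -!gaVK_nat E.
Qed.

Lemma End_scalar_act h X : End_scalar X -> End_scalar (T h X).
Proof.
have [v [vK Kv]] := gaVK_iso h X.
apply: (@End_scalar_faithful _ _ (fun f => gaVK h X ∘ gam A h^-1 f ∘ v)).
  by move=> f f' /(cancelr Kv)/(cancell Kv); exact: gam_inj.
by move=> c; rewrite gamZ gam1 cmpZr cmpZl cmpm1 vK.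
Qed.

Lemma coev_neq0 X : idm X <> 0 -> coev X <> 0.
Proof.
move=> n E; apply: n; rewrite -(lunK X).1 -zig E tenm0l.
by rewrite cmpm0 cmp0m.
Qed.

End CrossedFixed.

(** * Simple objects of degree h are fixed by T_h *)

Section CrossedFixedClosed.
Variables (k : closedFieldType) (G : finGroupType) (C : crossedcat k G).
Hypothesis fus : fusion C.
Local Notation A := (xact C).
Local Notation B := (xcr C).
Local Notation T := (ga A).
Implicit Types (X Y Z : C) (h l : G).

Lemma fusion_kernels : has_kernels C.
Proof. exact: ab_ker (fus_abelian fus). Qed.

(** This form of simplicity passes to duals and to T_h X by comparing endomorphism spaces, with no
    subobject to move. *)
Lemma fusion_simpleE X : simple X <-> End_scalar X.
Proof.
split=> [sX|]; first exact: (Schur_scalar fusion_kernels sX).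
exact: End_scalar_simple (fus_semisimple fus).
Qed.

Lemma dual_simple X : simple X -> simple (dual X).
Proof. by move/fusion_simpleE/End_scalar_dual/fusion_simpleE. Qed.

Lemma act_simple h X : simple X -> simple (T h X).
Proof. by move/fusion_simpleE/(End_scalar_act h)/fusion_simpleE. Qed.

(** After replacing Y by its double dual through [piv Y], duality turns [d] into a nonzero morphism
    [dual Y] -> X, to which Schur's lemma applies. *)
Lemma one_to_ten_iso X Y (d : hom one (X ⊗ Y)) :
  simple X -> simple Y -> d <> 0 -> iso (dual Y) X.
Proof.
move=> sX sY nd.
pose f := (idm X ⊠ piv Y) ∘ d.
pose u := run X ∘ (idm X ⊠ ev (dual Y)) ∘ ass X _ _ ∘ (f ⊠ idm (dual Y)).
have nf : f <> 0.
  by move/cancel0l => d0; apply/nd/d0/tenm_iso; [exact: isiso_idm | exact: piv_iso].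
have iu : isiso (luni (dual Y)) by exists (lun (dual Y)); case: (lunK (dual Y)).
exists (u ∘ luni (dual Y)).
apply: (Schur_iso fusion_kernels) => //; first exact: dual_simple.
move/(cancel0r iu) => u0; apply: nf; apply: uncurry_inj.
by rewrite tenm0l cmpm0; exact: u0.
Qed.

(* Both [dual Y] and [dual (T h Y)] are isomorphic to [T h (dual Y)]: the
   coevaluation of [Y] followed by the crossed braiding, resp. the image of
   the coevaluation of [dual Y] under [T h], gives a nonzero morphism from
   the unit to [T h (dual Y) ⊗ Y], resp. to [T h (dual Y) ⊗ T h Y]. *)
Lemma crossed_fixed h Y : simple Y -> deg B h Y -> iso (T h Y) Y.
Proof.
move=> sY dY; have sY' := dual_simple sY; have sTY := act_simple h sY.
have sTY' := act_simple h sY'; have [nY _] := sY; have [nY' _] := sY'.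
have iY : iso (dual Y) (T h (dual Y)).
  apply: (one_to_ten_iso (d := cr B h Y (dual Y) ∘ coev Y)) => //.
  by move/cancel0l => E; apply: (coev_neq0 nY); apply: E; exact: cr_iso.
have iT : iso (dual (T h Y)) (T h (dual Y)).
  have [p [pK Kp]] := piv_iso Y.
  have ip : isiso p by exists (piv Y).
  pose d := (idm _ ⊠ gam A h p) ∘ (gaJ A h _ _ ∘ (gam A h (coev (dual Y)) ∘ ga1i A h)).
  apply: (one_to_ten_iso (d := d)) => //.
  have i1 : isiso (idm (T h (dual Y)) ⊠ gam A h p).
    by apply: tenm_iso; [exact: isiso_idm | exact: gam_iso].
  move/(cancel0l i1)/cancel0l => E.
  apply: (coev_neq0 nY'); apply: (@gam_inj _ _ _ h); rewrite gam0.
  have i2 : isiso (ga1i A h) by exists (ga1 A h); case: (ga1K A h).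
  by apply: (cancel0r i2); apply: E; exists (gaJi A h _ _); exact: gaJK.
apply: iso_trans (bidual_iso _) _; apply: iso_trans _ (iso_sym (bidual_iso _)).
by apply: dual_iso; apply: iso_trans iY (iso_sym iT).
Qed.

End CrossedFixedClosed.

(** * Liftings for a cyclic group, from one isomorphism T_g X -> X *)

Section Lifting.
Variables (k : closedFieldType) (G : finGroupType) (C : crossedcat k G).
Local Notation A := (xact C).
Local Notation T := (ga A).
Variable X : C.
Implicit Types (h l : G).

(* Pairs (h, T_h X -> X) form a monoid, in which equality absorbs the
   transports [acast]; a lifting of X is a section of it over G. *)
Let pt := {h : G & hom (T h X) X}.
Implicit Types (p q r : pt).

Definition ptmul p q : pt := existT _ (tag p * tag q)%g
  (tagged p ∘ gam A (tag p) (tagged q) ∘ gaMi A (tag p) (tag q) X).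
Definition ptone : pt := existT _ 1%g (gaE A X).
Definition ptscale c p : pt := existT _ (tag p) (c *: tagged p).

Lemma pt_eq h l (e : h = l) (v : hom (T h X) X) (w : hom (T l X) X) :
  w ∘ acast T e X = v -> existT _ h v = existT _ l w :> pt.
Proof. by case: l / e w => w <-; rewrite cmpm1. Qed.

(** Equality in G is decidable, so the proof of h = h hidden in the equality of pairs is trivial. *)
Lemma pt_inj h (v w : hom (T h X) X) :
  existT _ h v = existT _ h w :> pt -> v = w.
Proof.
move=> E; have := projT2_eq E.
by rewrite (eq_irrelevance (projT1_eq E) erefl).
Qed.

Lemma pt_tag p h : tag p = h -> exists v, p = existT _ h v.
Proof. by case: p => l v /= <-; exists v. Qed.

Lemma ptmulA p q r : ptmul p (ptmul q r) = ptmul (ptmul p q) r.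
Proof.
case: p q r => h u [l v] [m w]; apply: (pt_eq (e := mulgA h l m)) => /=.
apply: (cancelr (gaMK A h (l * m)%g X).1).
apply: (cancelr (gam_inv h (gaMK A l m X)).1).
rewrite -!cmpA (cmpA (acast _ _ _)) -gaM_ass.
rewrite (cmpA (gaMi A (h * l)%g m X)) (gaMK A _ _ _).2 cmp1m -gaM_nat.
rewrite (cmpA (gaMi A h l X)) (gaMK A _ _ _).2 cmp1m.
rewrite (cmpA (gaMi A h _ X)) (gaMK A _ _ _).2 cmp1m -!gamM.
by rewrite -!cmpA (gaMK A _ _ _).2 cmpm1.
Qed.

Lemma pt1mul p : ptmul ptone p = p.
Proof.
case: p => h v; apply: (pt_eq (e := mul1g h)) => /=.
apply: (cancelr (gaMK A 1%g h X).1).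
by rewrite -!cmpA gaE_l (gaMK A _ _ _).2 cmpm1 gaE_nat.
Qed.

Lemma ptmulZ c d p q : ptmul (ptscale c p) (ptscale d q) = ptscale (c * d) (ptmul p q).
Proof.
case: p q => h u [l v]; rewrite /ptmul /ptscale /=; congr existT.
by rewrite gamZ cmpZr !cmpZl scalerA mulrC.
Qed.

Lemma ptscale1 p : ptscale 1 p = p.
Proof. by case: p => h v; rewrite /ptscale scale1r. Qed.

Definition ptexp p n := iter n (ptmul p) ptone.

Lemma ptexpD p m n : ptexp p (m + n) = ptmul (ptexp p m) (ptexp p n).
Proof.
by elim: m => [|m IH]; rewrite ?pt1mul // addSn /= IH ptmulA.
Qed.

Lemma tag_ptexp p n : tag (ptexp p n) = (tag p ^+ n)%g.
Proof. by elim: n => // n IH; rewrite expgS -IH. Qed.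

Lemma ptexpZ c p n : ptexp (ptscale c p) n = ptscale (c ^+ n) (ptexp p n).
Proof.
elim: n => [|n IH]; first by rewrite expr0 ptscale1.
by rewrite exprS -ptmulZ -IH.
Qed.

Lemma ptexp_iso p n : isiso (tagged p) -> isiso (tagged (ptexp p n)).
Proof.
move=> ip; elim: n => [|n IH] /=; first by exists (gaEi A X); exact: gaEK.
apply: isiso_cmp; last by exists (gaM A _ _ _); case: (gaMK A (tag p) (tag (ptexp p n)) X).
by apply: isiso_cmp ip _; apply: gam_iso.
Qed.

Lemma cyclic_lift (g : G) : generator [set: G] g -> End_scalar X -> iso (T g X) X ->
  exists X' : eqobj C, eqbase X' = X.
Proof.
move=> gen [nX S] [u iu]; have oG : #[g]%g = #|G| by rewrite /order -(eqP gen) cardsT.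
have [p [tp p1]] : exists p, tag p = g /\ ptexp p #|G| = ptone.
  pose q : pt := existT _ g u.
  have [|v Ev] := @pt_tag (ptexp q #|G|) 1%g; first by rewrite tag_ptexp -oG expg_order.
  have [c Ec] := S (v ∘ gaEi A X).
  have {Ec} vE : v = c *: gaE A X.
    by rewrite -[v]cmpm1 -(gaEK A X).2 cmpA Ec cmpZl cmp1m.
  (* The powers of an isomorphism are isomorphisms, so v is not 0. *)
  have c0 : c != 0.
    apply/eqP => c0; have := ptexp_iso #|G| (p := q) iu; rewrite Ev /= vE c0 scale0r.
    by case=> f [E _]; apply: nX; rewrite -E cmp0m.
  (* Rescaling u by t multiplies its power of exponent #|G| by t^#|G|, which has to be c^-1. *)
  have [t /eqP] : exists t, root ('X^#|G| - (c^-1)%:P) t.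
    by apply/closed_rootP; rewrite size_XnsubC -?oG // eqSS -lt0n.
  rewrite !hornerE => /eqP; rewrite subr_eq0 => /eqP Et.
  exists (ptscale t q); split=> //.
  by rewrite ptexpZ Ev vE /ptscale /= Et scalerA mulVf // scale1r.
(* As [ptexp p #|G|] is the neutral element, a power of p depends only on the exponent modulo the
   order of g, that is, on its tag. *)
have expE i j : (g ^+ i)%g = (g ^+ j)%g -> ptexp p i = ptexp p j.
  have mulE m : ptexp p (m * #|G|) = ptone.
    by elim: m => // m IH; rewrite mulSn ptexpD IH p1 pt1mul.
  have modE m : ptexp p m = ptexp p (m %% #|G|).
    by rewrite {1}(divn_eq m #|G|) ptexpD mulE pt1mul.
  move/eqP; rewrite eq_expg_mod_order oG => /eqP E.
  by rewrite modE E -modE.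
have [h|w wE] := @fin_all_exists G (fun h => hom (T h X) X)
    (fun h v => exists j, ptexp p j = existT _ h v).
  have /cycleP[j hj] : h \in <[g]>%g by rewrite -(eqP gen) inE.
  have [|v Ev] := @pt_tag (ptexp p j) h; first by rewrite tag_ptexp tp.
  by exists v, j.
have wexp j h : (g ^+ j)%g = h -> ptexp p j = existT _ h (w h).
  have [i Ei] := wE h; move=> hj; rewrite -Ei; apply: expE.
  by rewrite hj -tp -tag_ptexp Ei.
have wj h : exists2 j, (g ^+ j)%g = h & ptexp p j = existT _ h (w h).
  by have [j Ej] := wE h; exists j; rewrite // -tp -tag_ptexp Ej.
have wM h l : w (h * l)%g ∘ gaM A h l X = w h ∘ gam A h (w l).
  have [i Ei Pi] := wj h; have [j Ej Pj] := wj l.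
  have := ptexpD p i j; rewrite (wexp (i + j)%N (h * l)%g); last by rewrite expgD Ei Ej.
  rewrite Pi Pj => /pt_inj ->.
  by rewrite -!cmpA (gaMK A _ _ _).2 cmpm1.
have w1 : w 1%g = gaE A X.
  by apply: pt_inj; rewrite -(wexp 0%N).
by exists (EqObj (fam_iso wM w1) wM).
Qed.

End Lifting.

(** * Orbits of equivariant simple objects and their underlying simple objects *)

Section OrbitsOfLiftings.
Variables (k : closedFieldType) (G : finGroupType) (g : G) (C : crossedcat k G).
Hypotheses (ch0 : [pchar k] =i pred0) (gen : generator [set: G] g) (fus : fusion C).
Local Notation A := (xact C).
Local Notation B := (xcr C).
Local Notation T := (ga A).
Local Notation CG := (equivariantization C).
Implicit Types (X Y : eqobj C) (a : gchar k G) (h l : G).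

Let ab := fus_abelian fus.
Let kerCG := eq_kernels ab.

Lemma order_neq0 : #|'I_#|G| |%:R != 0 :> k.
Proof.
by rewrite card_ord; apply: pchar0_natr_neq0 => //; apply/card_gt0P; exists g.
Qed.

Lemma eqdegE h X : eqdeg h X <-> deg B h (eqbase X).
Proof.
have [a orth] := cyclic_characters ch0 gen.
exact: eqdeg_deg order_neq0 orth.
Qed.

(** The isotypic projections of [f] add up to a nonzero multiple of [f], so one of them is
    nonzero. *)
Lemma exists_twisted_hom X Y (f : hom (eqbase X) (eqbase Y)) : f <> 0 ->
  exists a (f' : @hom k CG (twist a X) Y), f' <> 0.
Proof.
have [a orth] := cyclic_characters ch0 gen => nf.
have [i ni] : exists i, proj_char (a i) f != 0.
  apply/existsP; apply: contra_notT nf; rewrite negb_exists => /forallP H.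
  apply: (scalerI order_neq0); rewrite scaler0 -(sum_proj_char f orth) big1 // => i _.
  by apply/eqP; have := H i; rewrite negbK.
exists (a i), (proj_hom (a i) f) => /eq_neq0 /= E.
by rewrite E eqxx in ni.
Qed.

Lemma orbit_iso X Y : simple (eqbase X) -> simple (eqbase Y) ->
  (exists a, @iso k CG X (Xchar C a ⊗ Y)) <-> iso (eqbase X) (eqbase Y).
Proof.
move=> sX sY; split=> [[a i]|/iso_sym[f i]].
  exact: (eq_iso_base (iso_trans i (Xchar_twist a Y))).
have [a [f' nf]] := exists_twisted_hom (isiso_neq0 (proj1 sY) i).
exists a; apply/iso_sym/(iso_trans (Xchar_twist a Y)); exists f'.
apply: (Schur_iso kerCG) nf; last exact: eq_simple_base.
by apply: twist_simple => //; apply: eq_simple_base.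
Qed.

(** A nonzero isotypic projection of an endomorphism is an isomorphism [twist a X] -> X, so its
    character is trivial. All endomorphisms in C are thus equivariant, hence scalar. *)
Lemma simple_base_trivial_stab X : @simple k CG X -> trivial_stab X -> simple (eqbase X).
Proof.
move=> sX st; apply/(fusion_simpleE fus); split=> [n|f].
  by case: sX => + _; apply; apply/eq_neq0.
have [a orth] := cyclic_characters ch0 gen.
suff Hf : f \in eqhom X X.
  have [_ /(_ (Subvs Hf))[c /(congr1 vsval) /= Ec]] := Schur_scalar kerCG sX.
  by exists c.
rewrite -[f]scale1r -(mulVf order_neq0) -scalerA -(sum_proj_char f orth).
apply/rpredZ/rpred_sum => i _.
have [->|/eqP ni] := eqVneq (proj_char (a i) f) 0; first exact: mem0v.
have ii : @isiso k CG _ _ (proj_hom (a i) f).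
  by apply: (Schur_iso kerCG) => //; [exact: twist_simple | move/eq_neq0].
apply/eqhomP => h; rewrite -proj_char_equiv /=.
rewrite (st (a i)) ?scale1r //.
by apply: iso_trans (Xchar_twist _ _) _; exists (proj_hom (a i) f).
Qed.

(** An isomorphism [twist a X] -> X is a nonzero scalar c on the underlying object, and equivariance
    reads c * a h = c. *)
Lemma trivial_stab_base X : simple (eqbase X) -> trivial_stab X.
Proof.
move=> /(fusion_simpleE fus)[nX S] a i h.
have [f /eq_isisoE i1] := iso_trans (iso_sym (Xchar_twist a X)) i.
have [c Ec] := S (vsval f).
have c0 : c != 0 by apply/eqP => c0; apply: (isiso_neq0 nX i1); rewrite Ec c0 scale0r.
have := eqhomE f h; rewrite Ec gamZ gam1 cmpZr cmpm1 /= cmpZl cmp1m scalerA.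
move/(congr1 (fun u => u ∘ fam_inv (eqlift X) h)).
rewrite !cmpZl eqlift_invr => /eqP; rewrite -subr_eq0 -scalerBl scaler_eq0.
case/orP=> /eqP // /eqP; rewrite -{2}[c]mulr1 -mulrBr mulf_eq0 (negPf c0) subr_eq0.
by move/eqP.
Qed.

Lemma crossed_lift (Y : C) : simple Y -> deg B g Y -> exists Y' : eqobj C, eqbase Y' = Y.
Proof.
move=> sY dY; apply: (cyclic_lift gen); first exact/(fusion_simpleE fus).
exact: crossed_fixed.
Qed.

(* A simple summand of the underlying object has a lifting, some twist of which
   maps nontrivially to the given simple object. *)
Lemma simple_base_crossed X : @simple k CG X -> deg B g (eqbase X) -> simple (eqbase X).
Proof.
move=> sX dX; have [m [F [i [p [sF [pi _ D]]]]]] := fus_semisimple fus (eqbase X).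
have [b _|E] := pickP 'I_m; last first.
  by case: sX => n _; case: n; apply/eq_neq0; rewrite /= -D big1 // => b; have := E b.
have [Y EY] := crossed_lift (sF b) (deg_retract (pi b) dX).
have sY : simple (eqbase Y) by rewrite EY.
have [f nf] : exists f : hom (eqbase Y) (eqbase X), f <> 0.
  rewrite EY; exists (i b) => i0; case: (sF b) => n _; apply: n.
  by rewrite -(pi b) i0 cmpm0.
have [a [f' nf']] := exists_twisted_hom nf.
have sY' : @simple k CG (twist a Y) by apply: twist_simple => //; apply: eq_simple_base.
have i' : @iso k CG (twist a Y) X by exists f'; apply: (Schur_iso kerCG).
exact: simple_iso (eq_iso_base i') sY.
Qed.

Lemma orbit_reps_base (P : CG -> Prop) (Q : C -> Prop) m (F : 'I_m -> CG) :
  (forall X, P X <-> Q (eqbase X)) -> (forall Z, Q Z -> simple Z) ->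
  (forall Z, Q Z -> exists X : eqobj C, eqbase X = Z) ->
  orbit_reps P F <-> iso_reps Q (fun i => eqbase (F i)).
Proof.
move=> PQ Qs Ql; have Ps X : P X -> simple (eqbase X) by move/PQ/Qs.
split=> -[PF U].
  have sF i := Ps _ (PF i); split=> [i|Z QZ]; first exact/PQ.
  have [X EX] := Ql Z QZ; rewrite -EX in QZ *; have sX := Qs _ QZ.
  have [i [Ei Ui]] := U X (proj2 (PQ X) QZ); exists i; split.
    exact/orbit_iso.
  by move=> j Ij; apply/Ui/orbit_iso.
have PFC i : P (F i) by apply/PQ.
have sF i := Ps _ (PFC i); split=> // X PX; have sX := Ps X PX.
have [i [Ei Ui]] := U (eqbase X) (proj1 (PQ X) PX).
exists i; split; first exact/orbit_iso.
by move=> j Ij; apply/Ui/orbit_iso.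
Qed.

End OrbitsOfLiftings.

(** * Equality of the entries of the two matrices *)

Section CrossedSmatrix.
Variables (k : closedFieldType) (G : finGroupType) (C : crossedcat k G).
Hypothesis fus : fusion C.
Local Notation A := (xact C).
Local Notation B := (xcr C).
Local Notation CG := (equivariantization C).

Lemma scalar_ofZ (D : pivcat k) c : idm (one : D) <> 0 -> scalar_of (c *: idm (one : D)) = c.
Proof.
move=> n; rewrite /scalar_of linearZ /=.
set b := [tuple _]; have fb : free b by rewrite seq1_free; apply/eqP.
by have := coord_free ord0 ord0 fb; rewrite /= => ->; rewrite mulr1.
Qed.

(** The two sides are coordinates in different Hom spaces. Both equal the c such that [vsval f] is c
    times the identity, which exists by Schur's lemma for the unit. *)
Lemma eq_scalar_of (f : @hom k CG one one) : scalar_of f = scalar_of (vsval f).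
Proof.
have [n S] := Schur_scalar (ab_ker (fus_abelian fus)) (fus_one fus).
have [c Ec] := S (vsval f).
have n' : idm (one : CG) <> 0 by move/(congr1 vsval).
have Ef : f = c *: idm (one : CG) by apply: subvs_inj; rewrite Ec.
by rewrite Ec (scalar_ofZ c n) Ef (scalar_ofZ c n').
Qed.

Lemma eq_trR (X : CG) (f : @hom k CG X X) : trR f = trR (vsval f).
Proof. exact: eq_scalar_of. Qed.

Lemma crossedSE g (X Y : eqobj C) : deg B 1%g (eqbase X) -> deg B g (eqbase Y) ->
  crossedS g X (eqbase Y) = Sentry (X : CG) Y.
Proof.
move=> dX dY; rewrite /Sentry eq_trR /crossedS; congr trR.
(* X and Y are homogeneous, so each braiding reduces to one crossed braiding followed by a lifting.
   In degree 1 the lifting of Y is [gaE], by [eqlift1]. *)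
have := cbrE (idm (eqbase X)) Y dX; have := cbrE (idm (eqbase Y)) X dY.
by rewrite !tenm1 !cmpm1 /= eqlift1 => -> ->.
Qed.

End CrossedSmatrix.

Theorem proposition1p6 (k : closedFieldType) (G : finGroupType) (g : G)
    (C : crossedcat k G) :
  [pchar k] =i pred0 -> generator [set: G] g -> fusion C ->
  let CG := equivariantization C in
  let I1n (X : CG) := [/\ simple X, eqdeg 1%g X & trivial_stab X] in
  let Ig (Y : CG) := simple Y /\ eqdeg g Y in
  [/\ forall m (F : 'I_m -> CG), orbit_reps I1n F <->
        iso_reps (fun X : C =>
          [/\ simple X, deg (xcr C) 1%g X & iso (ga (xact C) g X) X])
          (fun i => eqbase (F i)),
      forall n (H : 'I_n -> CG), orbit_reps Ig H <->
        iso_reps (fun Y : C => simple Y /\ deg (xcr C) g Y)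
          (fun j => eqbase (H j))
    & forall N (s : 'I_N -> CG), iso_reps (fun X : CG => simple X) s ->
      forall m n (p : 'I_m -> 'I_N) (q : 'I_n -> 'I_N),
        orbit_reps I1n (fun i => s (p i)) -> orbit_reps Ig (fun j => s (q j)) ->
        crossedS_mx g (fun i => s (p i)) (fun j => eqbase (s (q j)))
        = mxsub p q (Smatrix s)].
Proof.
move=> ch0 gen fus CG I1n Ig; have ab := fus_abelian fus; split.
- move=> m F; apply: (orbit_reps_base ch0 gen fus) => [X|Z []|Z [sZ _ iZ]] //.
    split=> [[sX /(eqdegE ch0 gen) dX st]|[sX dX _]]; split.
    + exact: (simple_base_trivial_stab ch0 gen fus sX st).
    + by [].
    + by exists (eqlift X g); exact: eqlift_iso.
    + exact: eq_simple_base.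
    + exact/(eqdegE ch0 gen).
    + exact: (trivial_stab_base fus sX).
  by apply: (cyclic_lift gen) iZ; apply/(fusion_simpleE fus).
- move=> n H; apply: (orbit_reps_base ch0 gen fus) => [Y|Z []|Z []] //.
    split=> [[sY /(eqdegE ch0 gen) dY]|[sY dY]]; split=> //.
    + exact: (simple_base_crossed ch0 gen fus).
    + exact: eq_simple_base.
    + exact/(eqdegE ch0 gen).
  exact: (crossed_lift gen fus).
move=> N s _ m n p q [Hp _] [Hq _]; apply/matrixP => i j; rewrite !mxE.
have [_ /(eqdegE ch0 gen) dX _] := Hp i; have [_ /(eqdegE ch0 gen) dY] := Hq j.
exact: (crossedSE fus).
Qed.
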